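(* Let $n$ be a non-negative integer and let $F$ be the filter in the poset $I_{n}^{\bullet}$ of pointed integer partitions of $n$ generated by a pointed knapsack partition $\{\lambda,\underline{m}\}=\{\lambda_1,\dots,\lambda_p,\underline{m}\}$ of $n$. Let $\Pi_n^{\bullet}(F)=\{\pi\in\Pi_n^\bullet:\mathrm{type}(\pi)\in F\}$. Then $$\mu\left(\Pi_{n}^{\bullet}(F)\cup\{\hat{0}\}\right)=(-1)^{p-1}\cdot\sum_{\vec{c}\in V}\beta(\vec{c}),$$ that is, $(-1)^{p-1}$ times the number of permutations in $\mathfrak{S}_n$ whose descent composition belongs to $V$.
   Context: A pointed integer partition of $n$ is a pair $\{\lambda,\underline{m}\}=\{\lambda_1,\dots,\lambda_k,\underline{m}\}$ where $m\ge 0$ is an integer (the pointed part) and $\lambda$ is an integer partition (multiset of positive integers) of $n-m$. The poset $I_n^{\bullet}$ is ordered by the cover relations: replacing two non-pointed parts by their sum, and replacing a non-pointed part $\lambda_k$ and the pointed part $m$ by the pointed part $\lambda_k+m$ (going up). The filter generated by $x$ is $\{y:x\le y\}$. A multiset $\lambda=\{e_1^{m_1},\dots,e_q^{m_q}\}$ of positive integers (distinct $e_i$, multiplicities $m_i$) is a knapsack partition if the number of distinct integers $\sum_{e\in\mu}e$, $\mu$ a sub-multiset of $\lambda$, equals $\prod_{i=1}^q(m_i+1)$; equivalently each such sum has a unique representation as a sum of a sub-multiset of $\lambda$. $\{\lambda,\underline{m}\}$ is a pointed knapsack partition if $\lambda$ is a knapsack partition. A pointed set partition of $\{1,\dots,n\}$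 is a pair $(\sigma,Z)$ with $Z\subseteq\{1,\dots,n\}$ (zero block) and $\sigma$ a set partition of the complement of $Z$; $\Pi_n^\bullet$ is ordered by refinement (each block of $\pi$ lies in a block, possibly the zero block, of $\pi'$, and zero block of $\pi$ lies in zero block of $\pi'$). Its type is $\{\{|B|:B\in\sigma\},\underline{|Z|}\}$. For a poset $P$ with minimum $\hat0$ and maximum $\hat1$, $\mu(P)=\mu_P(\hat0,\hat1)$; here $\hat0$ is an adjoined minimum and $\hat1$ is the partition with all elements in the zero block. A pointed composition of $n$ is a list $\vec{c}=(c_1,\dots,c_{k-1},\underline{c_k})$ of non-negative integers summing to $n$ with $c_1,\dots,c_{k-1}>0$; its type is $\{c_1,\dots,c_{k-1},\underline{c_k}\}$, and $C_n^\bullet(F)$ is the set of pointed compositions with type in $F$. $\beta(\vec{c})$: if $c_k>0$, the number of permutations in $\mathfrak{S}_n$ with descent set exactly $\{c_1,c_1+c_2,\dots,c_1+\dots+c_{k-1}\}$; if $k\ge2$ and $c_k=0$, $\beta(\vec c)=0$; $\beta((\underline0))=1$. The descent composition of a permutation with descent set $\{s_1<\dots<s_{k-1}\}$ is $(s_1,s_2-s_1,\dots,n-s_{k-1})$. $V=V(\lambda,\underline{m})$ is the set of pointed compositions $\vec{c}=(c_1,\dots,c_{k-1},\underline{m})$ in $C_n^\bullet(F)$ (last entry exactly $m$) such that, when each $c_i$ ($1\le i\le k-1$) is expressed (uniquely) as a sum of parts of $\lambda$, the summands for each $c_i$ are distinct. *)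

(* Defs.v *)
From HB Require Import structures.
From Stdlib Require Import Relations.
From mathcomp Require Import all_boot all_order all_algebra all_fingroup.
From mathcomp Require Import boolp.
Set Implicit Arguments. Unset Strict Implicit. Unset Printing Implicit Defensive.
Import GRing.Theory.

(* A pointed integer partition {lambda, m} is represented by the pair
   (lambda, m) : seq nat * nat; lambda is a multiset, i.e. a list considered
   up to permutation (perm_eq). *)
Definition pip := (seq nat * nat)%type.

Definition is_pip (n : nat) (x : pip) : bool :=
  all (fun e => 0 < e) x.1 && (sumn x.1 + x.2 == n).

Definition pip_eqv (a b : pip) : Prop := perm_eq a.1 b.1 /\ a.2 = b.2.

Definition pip_cover (a b : pip) : Prop :=
  (exists x y r, perm_eq a.1 [:: x, y & r] /\ perm_eq b.1 ((x + y) :: r)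
                 /\ b.2 = a.2)
  \/ (exists x r, perm_eq a.1 (x :: r) /\ perm_eq b.1 r /\ b.2 = x + a.2).

(* the order of I_n^bullet: reflexive-transitive closure of the covers
   (elements are multisets, hence the identification up to pip_eqv) *)
Definition pip_le (a b : pip) : Prop :=
  clos_refl_trans pip (fun u v => pip_cover u v \/ pip_eqv u v) a b.

Definition in_filter (x y : pip) : Prop := pip_le x y.

Definition knapsack (lam : seq nat) : bool :=
  size (undup [seq sumn (mask (tval t) lam) | t : (size lam).-tuple bool])
  == \prod_(e <- undup lam) (count_mem e lam).+1.

Definition psp (n : nat) := ({set {set 'I_n}} * {set 'I_n})%type.

Definition psp_valid n (p : psp n) : bool := partition p.1 (~: p.2).

Definition psp_type n (p : psp n) : pip :=
  ([seq #|B| | B : {set 'I_n} <- enum p.1], #|p.2|).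

Definition psp_le n (p q : psp n) : bool :=
  [forall B in p.1, (B \subset q.2) || [exists B' in q.1, B \subset B']]
  && (p.2 \subset q.2).

Definition psp_top n : psp n := (set0, [set: 'I_n]).

(* The poset is the subset of a finType T cut out by inP, ordered by le.
   mu(x,x) = 1, mu(x,y) = - sum_{x <= z < y} mu(x,z) for x < y, 0 otherwise.
   The fuel #|T| bounds the length of any chain, so it is never exhausted. *)
Fixpoint mobius_fuel (T : finType) (inP : pred T) (le : rel T) (k : nat)
  (x y : T) : int :=
  if x == y then 1%R else
  match k with
  | 0 => 0%R
  | k'.+1 =>
    if le x y then
      (- \sum_(z | inP z && le x z && le z y && (z != y))
            mobius_fuel inP le k' x z)%R
    else 0%R
  end.

Definition mobius (T : finType) (inP : pred T) (le : rel T) (x y : T) : int :=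
  mobius_fuel inP le #|T| x y.

Definition PiF_in n (x : pip) (o : option (psp n)) : bool :=
  match o with
  | None => true
  | Some p => psp_valid p && `[< in_filter x (psp_type p) >]
  end.

Definition PiF_le n (o1 o2 : option (psp n)) : bool :=
  match o1, o2 with
  | None, _ => true
  | Some _, None => false
  | Some p, Some q => psp_le p q
  end.

Definition mu_PiF n (x : pip) : int :=
  mobius (@PiF_in n x) (@PiF_le n) None (Some (psp_top n)).

(* one-line notation of s (values shifted to 0..n-1, order preserved) *)
Definition oneline n (s : {perm 'I_n}) : seq nat := [seq val (s i) | i <- enum 'I_n].

(* descent set {i in [1, n-1] : s(i) > s(i+1)} (1-indexed positions) *)
Definition descents n (s : {perm 'I_n}) : seq nat :=
  [seq i <- iota 1 n.-1 | nth 0 (oneline s) i.-1 > nth 0 (oneline s) i].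

Definition psums (cs : seq nat) : seq nat := [seq sumn (take i cs) | i <- iota 1 (size cs)].

Definition same_set (s t : seq nat) : bool := all (mem t) s && all (mem s) t.

(* beta of the pointed composition (c_1,...,c_{k-1}, underline ck),
   with cs = [:: c_1; ...; c_{k-1}], as a pointed composition of n *)
Definition beta (n : nat) (cs : seq nat) (ck : nat) : nat :=
  if 0 < ck then #|[set s : {perm 'I_n} | same_set (descents s) (psums cs)]|
  else if cs is [::] then 1 else 0.

(* all sequences of length <= b with entries in 1..b (a finite superset of
   all compositions of any k <= b) *)
Fixpoint seqs_len (l b : nat) : seq (seq nat) :=
  if l is l'.+1 then [seq x :: s | x <- iota 1 b, s <- seqs_len l' b] else [:: [::]].
Definition all_seqs (b : nat) : seq (seq nat) :=
  undup (flatten [seq seqs_len l b | l <- iota 0 b.+1]).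

(* c is expressed as a sum of parts of lam, and (that expression being
   unique for a knapsack lam) every such expression has distinct summands *)
Definition distinct_summands (lam : seq nat) (c : nat) : bool :=
  [exists t : (size lam).-tuple bool, sumn (mask t lam) == c] &&
  [forall t : (size lam).-tuple bool, (sumn (mask t lam) == c) ==> uniq (mask t lam)].

Definition in_V (n : nat) (lam : seq nat) (m : nat) (cs : seq nat) : bool :=
  all (fun c => 0 < c) cs && (sumn cs + m == n)
  && `[< in_filter (lam, m) (cs, m) >]
  && all (distinct_summands lam) cs.

Definition sum_beta_V (n : nat) (lam : seq nat) (m : nat) : int :=
  (\sum_(cs <- all_seqs n | in_V n lam m cs) (beta n cs m)%:Z)%R.

(* Main.v *)
(* By duality, mu(0,1) is the value at 0 of the function h which sums to [x = 1]
   over every principal filter.  On a pointed set partition with k blocks,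
   h = (-1)^k k!, i.e. the signed count of the orderings of its blocks, so that
   mu(0,1) = - sum (-1)^k over the ordered pointed partitions with type in F.
   Writing every block increasingly turns an ordered pointed partition into a
   permutation u together with a composition cs whose pieces of u are increasing.
   For fixed u, a refinement cs of type in F is a chain of submultisets of lambda
   (knapsack: a part determines its submultiset), and summing the signs over these
   chains solves a triangular linear system indexed by submultisets.  The solution is
   supported on the u whose descent composition decomposes lambda, with weights given
   by the Moebius function of a product of chains, which vanishes unless the summands
   are distinct: this is the condition defining V. *)

From Stdlib Require Import Relations.
Require Import Defs.
From mathcomp Require Import all_boot all_order all_algebra all_fingroup.
From mathcomp Require Import boolp zify ring.
Import GRing.Theory.
Set Implicit Arguments.
Unset Strict Implicit.
Unset Printing Implicit Defensive.

(** * Duality for Moebius functions *)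

Section MobiusDuality.

Variables (T : finType) (inP : pred T) (le : rel T).
Hypothesis le_refl : {in inP, reflexive le}.
Hypothesis le_anti : {in inP &, antisymmetric le}.
Hypothesis le_trans : {in inP & &, transitive le}.

Definition below y := [pred z | inP z && le z y && (z != y)].

(** Each recursive call moves to some [z] strictly below [y], and then [below z] is a proper subset
    of [below y]. So fuel [#|below y|] already suffices and any excess changes nothing. *)
Lemma mobius_fuel_indep k k' x y : inP x -> inP y ->
  #|below y| <= k -> #|below y| <= k' ->
  mobius_fuel inP le k x y = mobius_fuel inP le k' x y.
Proof.
move=> Px; elim: k k' y => [|k IH] [|k'] y Py //=.
- rewrite leqn0 => /eqP/card0_eq y0 _; case: ifP => // _; case: ifP => // _.
  rewrite big_pred0 ?oppr0 // => z; have := y0 z; rewrite !inE.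
  by case: (inP z) => //=; case: (le z y) => /=; rewrite ?andbF //= => ->; rewrite andbF.
- move=> _; rewrite leqn0 => /eqP/card0_eq y0; case: ifP => // _; case: ifP => // _.
  rewrite big_pred0 ?oppr0 // => z; have := y0 z; rewrite !inE.
  by case: (inP z) => //=; case: (le z y) => /=; rewrite ?andbF //= => ->; rewrite andbF.
move=> hk hk'; case: ifP => // _; case: ifP => // _; congr (- _)%R.
apply: eq_bigr => z /andP[/andP[/andP[Pz lexz] lezy] nzy].
have ltc : #|below z| < #|below y|.
  apply: proper_card; apply/properP; split.
    apply/subsetP => w; rewrite !inE => /andP[/andP[Pw lewz] nwz].
    rewrite Pw (le_trans Pz Pw Py lewz lezy) /=; apply/eqP => wy.
    by case/eqP: nzy; apply: le_anti => //; rewrite lezy -wy lewz.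
  by exists z; rewrite !inE ?eqxx ?andbF // Pz lezy nzy.
by apply: IH => //; rewrite -ltnS (leq_trans ltc).
Qed.

Lemma mobius_sum x y : inP x -> inP y -> le x y ->
  (\sum_(z | inP z && le x z && le z y) mobius inP le x z = (x == y)%:R)%R.
Proof.
move=> Px Py lexy; have [<-|nxy] := eqVneq x y.
  rewrite (bigD1 x) ?Px ?le_refl //= big_pred0 ?addr0.
    by rewrite /mobius; case: #|T| => [|k] /=; rewrite eqxx.
  move=> z; apply/negP => /andP[/andP[/andP[Pz xz] zx]] /eqP; apply.
  by apply: le_anti => //; rewrite zx xz.
rewrite (bigD1 y) ?Py ?lexy ?le_refl //=.
have -> : mobius inP le x y =
  (- \sum_(z | inP z && le x z && le z y && (z != y)) mobius inP le x z)%R.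
  rewrite {1}/mobius; case E: #|T| => [|k]; first by have := fintype0 y E.
  rewrite /= (negPf nxy) lexy; congr (- _)%R; apply: eq_bigr => z.
  move=> /andP[/andP[/andP[Pz lexz] lezy] nzy].
  (* One unit of fuel has been spent, leaving [k] where [#|T| = k.+1]. This still suffices because
     [below z] omits [z] itself. *)
  apply: mobius_fuel_indep => //; last exact: max_card.
  rewrite -ltnS -E -cardsT; apply: proper_card; apply/properP; split.
    by apply/subsetP => w; rewrite inE.
  by exists z; rewrite ?inE ?eqxx ?andbF.
by rewrite addNr.
Qed.

(** Evaluate the sum of [mobius inP le bot x * h y] over all pairs [x <= y] in both orders: summing
    over [y] first leaves only [x = top], summing over [x] first leaves only [y = bot]. *)
Lemma mobius_dual (h : T -> int) bot top : inP bot -> inP top ->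
  {in inP, forall x, le bot x} -> {in inP, forall x, le x top} ->
  (forall x, inP x -> (\sum_(y | inP y && le x y) h y = (x == top)%:R)%R) ->
  mobius inP le bot top = h bot.
Proof.
move=> Pb Pt leb let_ sumh.
have : (\sum_(x | inP x) \sum_(y | inP y && le x y) mobius inP le bot x * h y =
        \sum_(y | inP y) \sum_(x | inP x && le x y) mobius inP le bot x * h y)%R.
  rewrite (exchange_big_dep inP) /=; last by move=> x y _ /andP[].
  by apply: eq_bigr => y Py; apply: eq_bigl => x; rewrite Py.
have -> : (\sum_(x | inP x) \sum_(y | inP y && le x y) mobius inP le bot x * h y
           = mobius inP le bot top)%R.
  rewrite (bigD1 top) //= -mulr_sumr sumh // eqxx mulr1 big1 ?addr0 // => x.
  by case/andP=> Px nx; rewrite -mulr_sumr sumh // (negPf nx) mulr0.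
move=> ->; rewrite (bigD1 bot) //= -mulr_suml.
have E y : inP y ->
  (\sum_(x | inP x && le x y) mobius inP le bot x = (bot == y)%:R)%R.
  move=> Py; rewrite -mobius_sum ?leb //; apply: eq_bigl => x.
  by have [Px|] //= := boolP (inP x); rewrite leb.
rewrite E // eqxx mul1r big1 ?addr0 // => y /andP[Py ny].
by rewrite -mulr_suml E // eq_sym (negPf ny) mul0r.
Qed.

End MobiusDuality.

(** * Compositions, ordered partitions and words *)

Lemma allpairs_uniq_in (S T R : eqType) (f : S -> T -> R) s (t : S -> seq T) :
  uniq s -> {in s, forall x, uniq (t x)} ->
  (forall x y x' y', x \in s -> y \in t x -> x' \in s -> y' \in t x' ->
     f x y = f x' y' -> x = x' /\ y = y') ->
  uniq [seq f x y | x <- s, y <- t x].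
Proof.
move=> us ut inj; apply: (@allpairs_uniq_dep _ (fun=> T)) => // p q.
case/allpairsPdep=> x [y [xs yt ->]] /allpairsPdep[x' [y' [xs' yt' ->]]] /=.
by case/inj => // -> ->.
Qed.

Section Compositions.

Fixpoint comps_rec (k r : nat) : seq (seq nat) :=
  [::] :: if k is k'.+1 then [seq x :: s | x <- iota 1 r, s <- comps_rec k' (r - x)]
          else [::].

Lemma comps_rec_indep k k' r : r <= k -> r <= k' -> comps_rec k r = comps_rec k' r.
Proof.
elim: k k' r => [|k IH] [|k'] r //=; rewrite ?leqn0.
- by move=> /eqP ->.
- by move=> _ /eqP ->.
move=> hk hk'; congr (_ :: flatten _); apply/eq_in_map => x.
rewrite mem_iota => /andP[x0 _].
by rewrite (IH k') // leq_subLR; [apply: leq_trans hk _|apply: leq_trans hk' _];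
  rewrite -add1n leq_add2r.
Qed.

(** Only the non-pointed entries are listed. Their sum may be anything up to [r], and the remainder
    is the pointed entry. *)
Definition comps r := comps_rec r r.

Lemma compsE r :
  comps r = [::] :: [seq x :: s | x <- iota 1 r, s <- comps (r - x)].
Proof.
rewrite /comps; case: r => // r.
rewrite -[LHS]/([::] :: [seq x :: s | x <- iota 1 r.+1, s <- comps_rec r (r.+1 - x)]).
congr (_ :: flatten _).
 apply/eq_in_map => x.
rewrite mem_iota => /andP[x0 _]; rewrite (@comps_rec_indep _ (r.+1 - x)) //.
by rewrite leq_subLR -add1n leq_add2r.
Qed.

Lemma sum_comps (V : nmodType) r (F : seq nat -> V) :
  (\sum_(cs <- comps r) F cs =
   F [::] + \sum_(1 <= x < r.+1) \sum_(cs <- comps (r - x)) F (x :: cs))%R.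
Proof. by rewrite compsE big_cons big_allpairs_dep /index_iota subn1. Qed.

Lemma mem_comps r cs : (cs \in comps r) = all (fun c => 0 < c) cs && (sumn cs <= r).
Proof.
elim: cs r => [|x cs IH] r; first by rewrite compsE inE.
rewrite compsE inE /=; apply/allpairsPdep/idP => [[y [s [yr sr [exy ecs]]]]|].
  subst y s; move: yr sr; rewrite mem_iota IH add1n ltnS => /andP[-> xr] /andP[-> ].
  by rewrite leq_subRL.
case/andP=> /andP[x0 c0] sr; exists x, cs.
have xr : x <= r by apply: leq_trans sr; apply: leq_addr.
by rewrite mem_iota IH add1n ltnS x0 c0 xr leq_subRL.
Qed.

Lemma comps_uniq r : uniq (comps r).
Proof.
elim/ltn_ind: r => r IH; rewrite compsE /=; apply/andP; split.
  by apply/negP => /allpairsPdep[x [s [_ _]]].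
apply: allpairs_uniq_in; rewrite ?iota_uniq //.
  move=> x; rewrite mem_iota => /andP[x0 xr]; apply: IH.
  by rewrite add1n ltnS in xr; rewrite ltn_subrL x0 (leq_trans x0).
by move=> x y x' y' _ _ _ _ [].
Qed.

End Compositions.

(** * Ordered pointed set partitions as lists of blocks *)

Section OrderedPartitions.

Variable T : finType.
Implicit Types (D B : {set T}) (l : seq {set T}).

Definition nonempty_subsets D := enum [set B : {set T} | (B != set0) && (B \subset D)].

Fixpoint ops_rec (k : nat) D : seq (seq {set T}) :=
  [::] :: if k is k'.+1 then
    [seq B :: l | B <- nonempty_subsets D, l <- ops_rec k' (D :\: B)] else [::].

Lemma card_setD_lt B D : B != set0 -> B \subset D -> #|D :\: B| < #|D|.
Proof.
move=> /set0Pn[x xB] sBD; apply: proper_card; apply/properP; split.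
  exact: subsetDl.
by exists x; rewrite ?inE ?xB ?(subsetP sBD).
Qed.

Lemma ops_rec_indep k k' D : #|D| <= k -> #|D| <= k' -> ops_rec k D = ops_rec k' D.
Proof.
have E0 : nonempty_subsets set0 = [::].
  rewrite /nonempty_subsets; apply/eqP; rewrite -size_eq0 -cardE cards_eq0.
  by apply/eqP/setP => B; rewrite !inE subset0 andNb.
elim: k k' D => [|k IH] [|k'] D //=; rewrite ?leqn0 ?cards_eq0.
- by move=> /eqP ->; rewrite E0.
- by move=> _ /eqP ->; rewrite E0.
move=> hk hk'; congr (_ :: flatten _); apply/eq_in_map => B.
rewrite mem_enum inE => /andP[B0 BD]; have lt := card_setD_lt B0 BD.
by rewrite (IH k') // -ltnS (leq_trans lt).
Qed.

(* [ops D] enumerates the lists of disjoint nonempty subsets of [D]; what they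
   leave out of the ground set is the zero block. *)
Definition ops D := ops_rec #|D| D.

Lemma opsE D : ops D = [::] :: [seq B :: l | B <- nonempty_subsets D, l <- ops (D :\: B)].
Proof.
rewrite /ops (@ops_rec_indep _ #|D|.+1) //=; congr (_ :: flatten _).
 apply/eq_in_map => B.
rewrite mem_enum inE => /andP[B0 BD]; by rewrite (@ops_rec_indep _ #|D :\: B|) // ltnW // card_setD_lt.
Qed.

Lemma sum_ops (V : nmodType) D (F : seq {set T} -> V) :
  (\sum_(l <- ops D) F l =
   F [::] + \sum_(B : {set T} | (B != set0) && (B \subset D)) \sum_(l <- ops (D :\: B)) F (B :: l))%R.
Proof.
rewrite opsE big_cons big_allpairs_dep; congr (_ + _)%R.
by rewrite big_enum /=; apply: eq_bigl => B; rewrite inE.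
Qed.

Lemma mem_ops D l : (l \in ops D) =
  [&& all (fun B => B != set0) l, all (fun B => B \subset D) l &
      pairwise (fun A B => [disjoint A & B]) l].
Proof.
elim: l D => [|B l IH] D; first by rewrite opsE inE.
have -> : (B :: l \in ops D) = [&& B != set0, B \subset D & l \in ops (D :\: B)].
  rewrite opsE inE /=; apply/allpairsPdep/idP => [[B' [l' [B'D lD [eB el]]]]|].
    by subst B' l'; move: B'D; rewrite mem_enum inE => /andP[-> ->].
  by case/and3P=> B0 BD lD; exists B, l; rewrite mem_enum inE B0 BD.
rewrite IH /=; case: (B != set0) => //=; case: (B \subset D) => //=; last by rewrite andbF.
case: (all _ l) => //=; rewrite andbA; congr andb; rewrite -all_predI.
by apply: eq_all => A /=; rewrite subsetD [in RHS]disjoint_sym.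
Qed.

Lemma ops_uniq D : uniq (ops D).
Proof.
have [k] := ubnP #|D|; elim: k D => // k IH D hk; rewrite opsE /=; apply/andP; split.
  by apply/negP => /allpairsPdep[x [s [_ _]]].
apply: allpairs_uniq_in; rewrite ?enum_uniq //; last by move=> x y x' y' _ _ _ _ [].
move=> B; rewrite mem_enum inE => /andP[B0 BD]; apply: IH.
exact: leq_trans (card_setD_lt B0 BD) _.
Qed.

End OrderedPartitions.

(** * From ordered partitions to words cut into increasing pieces *)

Section Words.

Variable n : nat.
Implicit Types D B : {set 'I_n}.

Definition vals D : seq nat := map val (enum D).

Lemma vals_sorted D : sorted leq (vals D).
Proof.
apply: (@sub_sorted _ ltn); first by move=> x y /ltnW.
rewrite /vals {1}/enum_mem -enumT /=.
apply: (subseq_sorted ltn_trans (s2 := map val (enum 'I_n))).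
  by apply: map_subseq; apply: filter_subseq.
by rewrite val_enum_ord iota_ltn_sorted.
Qed.

Lemma vals_uniq D : uniq (vals D).
Proof. by rewrite map_inj_uniq ?enum_uniq //; apply: val_inj. Qed.

Lemma mem_vals D (i : 'I_n) : (val i \in vals D) = (i \in D).
Proof. by rewrite mem_map ?mem_enum //; apply: val_inj. Qed.

Lemma size_vals D : size (vals D) = #|D|.
Proof. by rewrite size_map -cardE. Qed.

Lemma vals_inj : injective vals.
Proof. by move=> A B E; apply/setP => i; rewrite -!mem_vals E. Qed.

Lemma perm_vals_cat B D : B \subset D -> perm_eq (vals D) (vals B ++ vals (D :\: B)).
Proof.
move=> BD; apply: uniq_perm; rewrite ?vals_uniq //.
  rewrite cat_uniq !vals_uniq andbT; apply/hasPn => x /mapP[i].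
  by rewrite mem_enum inE => /andP[iB _] ->; rewrite mem_vals.
move=> x; rewrite mem_cat; apply/idP/orP => [/mapP[i]|].
  by rewrite mem_enum => iD ->; rewrite !mem_vals inE iD andbT; case: (i \in B); [left|right].
case=> /mapP[i]; rewrite mem_enum ?inE => iB ->; rewrite mem_vals.
  exact: (subsetP BD).
by case/andP: iB.
Qed.

Lemma vals_of_sorted D (s : seq nat) : sorted leq s -> uniq s -> {subset s <= vals D} ->
  exists2 B : {set 'I_n}, B \subset D & s = vals B.
Proof.
move=> ss us sD; exists [set i | val i \in s].
  by apply/subsetP => i; rewrite inE => /sD; rewrite mem_vals.
apply: (sorted_eq leq_trans anti_leq) => //; first exact: vals_sorted.
apply: uniq_perm => //; first exact: vals_uniq.
move=> x; apply/idP/idP => [xs|/mapP[i]]; last by rewrite mem_enum inE => ? ->.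
by have /mapP[i iD xi] := sD _ xs; rewrite xi mem_vals inE -xi.
Qed.

(** A word whose prefix of length [x] increases amounts to a set [B] of size [x], listed
    increasingly, followed by an arbitrary word on the complement of [B] in [D]. *)
Lemma sum_permutations_take (V : nmodType) D x (F : seq nat -> V) : x <= #|D| ->
  (\sum_(u <- permutations (vals D) | sorted leq (take x u)) F (drop x u) =
   \sum_(B : {set 'I_n} | (B \subset D) && (#|B| == x))
      \sum_(v <- permutations (vals (D :\: B))) F v)%R.
Proof.
move=> xD; rewrite -big_filter.
set Bs := enum [set B : {set 'I_n} | (B \subset D) && (#|B| == x)].
rewrite (perm_big [seq vals B ++ v | B <- Bs, v <- permutations (vals (D :\: B))]) /=.
  rewrite big_allpairs_dep /Bs big_enum /=; apply: eq_big => [B|B]; first by rewrite inE.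
  rewrite inE => /andP[_ /eqP Bx]; apply: eq_bigr => v _.
  by rewrite drop_size_cat // size_vals.
have szB B : B \in Bs -> size (vals B) = x.
  by rewrite mem_enum inE => /andP[_ /eqP <-]; rewrite size_vals.
apply: uniq_perm; first by rewrite filter_uniq ?permutations_uniq.
  apply: allpairs_uniq_in; rewrite ?enum_uniq //.
    by move=> B _; apply: permutations_uniq.
  move=> B v B' v' /szB sB _ /szB sB' _ E.
  have /eqP := E; rewrite eqseq_cat ?sB ?sB' // => /andP[/eqP/vals_inj -> /eqP ->].
  by [].
move=> u; rewrite mem_filter mem_permutations; apply/andP/allpairsPdep.
  case=> su pu.
  have uu : uniq u by rewrite (perm_uniq pu) vals_uniq.
  have [B BD Bu] : exists2 B : {set 'I_n}, B \subset D & take x u = vals B.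
    apply: vals_of_sorted; rewrite ?take_uniq // => y /mem_take.
    by rewrite (perm_mem pu).
  have sz : size u = #|D| by rewrite (perm_size pu) size_vals.
  exists B, (drop x u); split; last by rewrite -Bu cat_take_drop.
    by rewrite mem_enum inE BD -size_vals -Bu size_take_min sz; apply/eqP/minn_idPl.
  rewrite mem_permutations -(perm_cat2l (vals B)) -{1}Bu cat_take_drop.
  exact: perm_trans pu (perm_vals_cat BD).
case=> B [v [BB]]; rewrite mem_permutations => pv ->.
rewrite take_size_cat ?szB // vals_sorted; split=> //.
have BD : B \subset D by move: BB; rewrite mem_enum inE => /andP[].
by rewrite perm_sym (permPl (perm_vals_cat BD)) perm_cat2l perm_sym.
Qed.

(** The last piece, left over after the cuts, stands for the zero block and may be empty. *)
Fixpoint psorted (cs u : seq nat) : bool :=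
  if cs is x :: cs' then sorted leq (take x u) && psorted cs' (drop x u)
  else sorted leq u.

(* A list of blocks becomes a word by listing each block increasingly; [cs] cuts
   the word back into blocks. *)
Lemma sum_ops_words D (F : seq nat -> int) :
  (\sum_(l <- ops D) F [seq #|B| | B : {set 'I_n} <- l] =
   \sum_(u <- permutations (vals D)) \sum_(cs <- comps #|D|) F cs * (psorted cs u)%:R)%R.
Proof.
have [k] := ubnP #|D|; elim: k D F => // k IH D F hk.
rewrite sum_ops [in RHS](eq_bigr _ (fun u _ => sum_comps _ _)) big_split /=; congr (_ + _)%R.
  (* The empty list of blocks matches the empty [cs], which only the increasing word [vals D]
     satisfies. *)
  rewrite -mulr_sumr (bigD1_seq (vals D)) ?permutations_uniq ?mem_permutations //=.
  rewrite vals_sorted big1_seq ?addr0 ?mulr1 // => u /andP[nu].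
  rewrite mem_permutations => pu; case: (boolP (sorted _ _)) => // su; case/eqP: nu.
  by apply: (sorted_eq leq_trans anti_leq) => //; apply: vals_sorted.
rewrite exchange_big /=.
(* Group by the size [x] of the first block [B]; in the word, [B] is the increasing prefix of length
   [x]. *)
transitivity (\sum_(1 <= x < #|D|.+1) \sum_(B : {set 'I_n} | (B \subset D) && (#|B| == x))
   \sum_(l <- ops (D :\: B)) F (#|B| :: [seq #|B| | B : {set 'I_n} <- l]))%R; last first.
  apply: eq_big_nat => x /andP[x0 xD].
  under [RHS]eq_bigr => u _.
    under eq_bigr => cs _ do rewrite /= -mulnb natrM mulrCA.
    rewrite -mulr_sumr; over.
  rewrite (eq_bigr (fun u => if sorted leq (take x u) then
     \sum_(cs <- comps (#|D| - x)) F (x :: cs) * (psorted cs (drop x u))%:R else 0)%R); last first.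
    by move=> u _; case: ifP; rewrite ?mul1r ?mul0r.
  rewrite -big_mkcond (sum_permutations_take (fun v =>
    \sum_(cs <- comps (#|D| - x)) F (x :: cs) * (psorted cs v)%:R)%R) //.
  apply: eq_bigr => B /andP[BD /eqP Bx]; subst x.
  have cD : #|D :\: B| = #|D| - #|B| by rewrite cardsD (setIidPr BD).
  rewrite (IH _ (fun cs => F (#|B| :: cs))) ?cD //.
  by rewrite -cD; apply: leq_trans (card_setD_lt _ BD) _; rewrite -?card_gt0.
rewrite [RHS]big_nat_cond [RHS](exchange_big_dep (fun B : {set 'I_n} => (B != set0) && (B \subset D))) /=.
  apply: eq_bigr => B /andP[B0 BD].
  have B1 : 0 < #|B| by rewrite card_gt0.
  under [RHS]eq_bigl => x do rewrite BD andTb andbT.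
  rewrite -big_nat_cond.
  rewrite (eq_bigl (fun x => x == #|B|)); last by move=> x; rewrite eq_sym.
  by rewrite big_nat1_eq B1 ltnS subset_leq_card.
move=> x B /andP[/andP[x0 _] _] /andP[BD /eqP Bx]; by rewrite BD -card_gt0 Bx x0.
Qed.

End Words.

(** * Chains of multisets *)

Section Multisets.

Variable n : nat.

(* [M e] is the multiplicity of the part [e.+1] *)
Definition mset := {ffun 'I_n -> 'I_n.+1}.
Implicit Types M X : mset.

Definition mle X M := [forall e : 'I_n, X e <= M e].

Definition msum M : nat := \sum_(e < n) e.+1 * M e.

Definition msize M : nat := \sum_(e < n) M e.

Definition mempty M := [forall e : 'I_n, M e == 0 :> nat].

Lemma mleP X M : reflect (forall e : 'I_n, X e <= M e) (mle X M).
Proof. exact: forallP. Qed.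

Lemma mle_refl M : mle M M.
Proof. by apply/mleP. Qed.

Lemma mle_trans : transitive mle.
Proof.
by move=> Y X M /mleP h1 /mleP h2; apply/mleP => e; apply: leq_trans (h1 e) (h2 e).
Qed.

Lemma msum_le X M : mle X M -> msum X <= msum M.
Proof. by move/mleP => h; apply: leq_sum => e _; rewrite leq_mul2l h orbT. Qed.

(** The weights [e.+1] in [msum] are positive, so equality of the sums forces equality of every
    multiplicity. *)
Lemma mle_eq X M : mle X M -> msum X = msum M -> X = M.
Proof.
move=> h E; apply/ffunP => e; apply: val_inj => /=; apply/eqP.
have [_ H] := leqif_sum (fun (e : 'I_n) (_ : true) =>
   conj (leq_mul (leqnn e.+1) (mleP _ _ h e)) (eqn_pmul2l (n1 := X e) (n2 := M e) (ltn0Sn e))).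
by move: H; rewrite -!/(msum _) E eqxx => /esym/forall_inP/(_ e isT).
Qed.

Lemma mempty_msum M : mempty M = (msum M == 0).
Proof.
rewrite /msum sum_nat_eq0; apply/eq_forallb => e.
by rewrite muln_eq0.
Qed.

(** The Moebius function of a chain, as a function of the distance between the two ends. *)
Definition coef (d : nat) : int := if d is d'.+1 then (if d' is 0 then -1 else 0)%R else 1%R.

Definition mcoef M X : int := (\prod_(e < n) coef (M e - X e))%R.

Lemma mcoef_refl M : mcoef M M = 1%R.
Proof. by apply: big1 => e _; rewrite subnn. Qed.

Lemma sum_coef a b : a <= b -> b <= n ->
  (\sum_(j < n.+1 | (a <= j <= b)%N) coef (j - a) = (a == b)%:R)%R.
Proof.
move=> ab bn.
have ha : a < n.+1 by lia.
rewrite (bigD1 (Ordinal ha)) /= ?leqnn ?ab // subnn /=.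
have [ab'|nab] := eqVneq a b.
  rewrite big_pred0 ?addr0 // => j; apply/negbTE/negP => /andP[h /eqP]; apply.
  by apply: val_inj => /=; lia.
have hb : a.+1 < n.+1 by lia.
rewrite (bigD1 (Ordinal hb)) /=; last first.
  by apply/andP; split; [lia|apply/eqP => /(congr1 val) /=; lia].
rewrite subSnn /= big1 ?addr0 ?addrN // => j /andP[/andP[h ja] jb].
have ja' : val j != a by apply: contra ja => /eqP e; apply/eqP/val_inj.
have jb' : val j != a.+1 by apply: contra jb => /eqP e; apply/eqP/val_inj.
have -> : (j - a = (j - a - 2).+2)%N by move: ja' jb' => /=; lia.
by [].
Qed.

(* [mcoef] is the Moebius function of the product of chains [mle]. *)
Lemma sum_mcoef X M : mle X M ->
  (\sum_(Y | mle X Y && mle Y M) mcoef Y X = (X == M)%:R)%R.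
Proof.
move=> /mleP XM.
have E (Y : mset) : ((if mle X Y && mle Y M then mcoef Y X else 0) =
  \prod_(e < n) (if (X e <= Y e <= M e)%N then coef (Y e - X e) else 0))%R.
  case: ifP => [/andP[/mleP h1 /mleP h2]|].
    by apply: eq_bigr => e _; rewrite h1 h2.
  move/negbT; rewrite negb_and => /orP[] /forallPn[e he]; rewrite (bigD1 e) //=.
    by rewrite (negPf he) mul0r.
  by rewrite (negPf he) andbF mul0r.
rewrite big_mkcond (eq_bigr _ (fun Y _ => E Y)).
rewrite -(bigA_distr_bigA (fun (e : 'I_n) (j : 'I_n.+1) =>
   if (X e <= j <= M e)%N then coef (j - X e) else 0%R)).
rewrite (eq_bigr (fun e : 'I_n => (X e == M e :> nat)%:R%R)); last first.
  by move=> e _; rewrite -big_mkcond sum_coef // -ltnS.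
have [<-|nXM] := eqVneq X M; first by apply: big1 => e _; rewrite eqxx.
have /existsP[e he] : [exists e : 'I_n, X e != M e :> nat].
  rewrite -negb_forall; apply: contra nXM => /forallP h.
  by apply/eqP/ffunP => e; apply: val_inj; apply/eqP; apply: h.
by rewrite (bigD1 e) //= (negPf he) mul0r.
Qed.

Definition below_by M x := [pred X : mset | mle X M && (msum X + x == msum M)].

(* The number of ways to remove from [M] successive submultisets of sums [cs]. *)
Fixpoint dec M (cs : seq nat) : nat :=
  if cs is x :: cs' then \sum_(X in below_by M x) dec X cs' else 1.

(** In contrast to [dec], the parts in [cs] must use up all of [M], and every removal carries its
    Moebius weight. *)
Fixpoint vdec M (cs : seq nat) : int :=
  if cs is x :: cs' then (\sum_(X in below_by M x) mcoef M X * vdec X cs')%R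
  else (mempty M)%:R%R.

(* [pexact] asks for the increasing runs of [u] to be maximal, where [psorted] only
   asks for the pieces to be increasing. *)
Fixpoint pexact (cs u : seq nat) : bool :=
  if cs is x :: cs' then
    [&& sorted leq (take x u), ~~ sorted leq (take x.+1 u) & pexact cs' (drop x u)]
  else sorted leq u.

Variable m : nat.

Definition refine_sum M (u : seq nat) : int :=
  (\sum_(cs <- comps (size u)) (-1) ^+ size cs * (dec M cs)%:R * (psorted cs u)%:R)%R.

Definition run_sum M (u : seq nat) : int :=
  (\sum_(cs <- comps (size u) | (sumn cs + m == size u)%N) vdec M cs * (pexact cs u)%:R)%R.

(** The amount removed is determined by what is left: [x = msum M - msum X], and [x > 0] says
    exactly that [X] differs from [M]. *)
Lemma sum_iota_below (F : nat -> mset -> int) M r : msum M <= r ->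
  (\sum_(1 <= x < r.+1) \sum_(X in below_by M x) F x X =
   \sum_(X | mle X M && (X != M)) F (msum M - msum X)%N X)%R.
Proof.
move=> Mr; rewrite big_nat_cond.
rewrite (exchange_big_dep (fun X : mset => mle X M && (X != M))) /=; last first.
  move=> x X /andP[/andP[x0 _] _] /andP[XM /eqP e]; rewrite XM; apply/eqP => XeM.
  by move: e x0; rewrite XeM; lia.
apply: eq_bigr => X /andP[XM nXM].
have lt : msum X < msum M.
  by rewrite ltn_neqAle msum_le // andbT; apply: contra nXM => /eqP/(mle_eq XM)/eqP.
under eq_bigl => x do rewrite inE XM andbT /=.
rewrite -big_nat_cond (eq_bigl (fun x => x == msum M - msum X)); last by move=> x; lia.
by rewrite big_nat1_eq ifT //; lia.
Qed.

(* Read as a triangular system indexed by submultisets, this equation determines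
   [refine_sum]; [run_sumE] exhibits its solution. *)
Lemma refine_sumE M u : size u = msum M + m ->
  (\sum_(X | mle X M) (sorted leq (take (msum M - msum X) u))%:R *
      refine_sum X (drop (msum M - msum X) u) = (sorted leq u)%:R)%R.
Proof.
move=> su; rewrite (bigD1 M) ?mle_refl //= subnn take0 drop0 mul1r.
rewrite {1}/refine_sum sum_comps /= !mul1r.
under eq_bigr => x _.
  under eq_bigr => cs _ do rewrite exprS natr_sum mulr_sumr mulr_suml.
  rewrite exchange_big /=.
  over.
rewrite (sum_iota_below (fun x X => \sum_(cs <- comps (size u - x))
  (-1 * (-1) ^+ size cs * (dec X cs)%:R * (sorted leq (take x u) && psorted cs (drop x u))%:R)%R)%R); last lia.
(* The compositions [x :: cs] in [refine_sum M u] carry one extra sign and cancel the terms of the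
   proper submultisets [X]; only the empty composition, giving [sorted leq u], survives. *)
rewrite -addrA -big_split /= big1 ?addr0 // => X /andP[XM nXM].
rewrite /refine_sum size_drop mulr_sumr -big_split /= big1 // => cs _.
by rewrite -mulnb natrM; ring.
Qed.

End Multisets.

Section Runs.

(** [d] is the length of the longest increasing prefix. Quantifying over all [x] also forces [u] to
    be unsorted, so there is a descent at [d]. *)
Definition first_run (u : seq nat) d := forall x, sorted leq (take x u) = (x <= d).

Lemma first_runP u : ~~ sorted leq u -> exists d, first_run u d.
Proof.
move=> nu; have ex : exists x, ~~ sorted leq (take x u) by exists (size u); rewrite take_size.
case: (ex_minnP ex) => -[|d]; first by rewrite take0.
move=> nd dmin; exists d => x; case: leqP => xd.
  by apply: contraTT xd => /dmin; rewrite -ltnNge.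
apply: contraNF nd => sx; rewrite -(take_takel u xd); exact: take_sorted.
Qed.

Lemma first_run_gt0 u d : first_run u d -> 0 < d.
Proof. by move=> fd; rewrite -fd; case: u {fd} => //= a u; rewrite take0. Qed.

Lemma first_run_lt_size u d : first_run u d -> ~~ sorted leq u -> d < size u.
Proof. by move=> fd; rewrite -[X in sorted _ X]take_size fd -ltnNge. Qed.

Lemma first_run_unsorted u d : first_run u d -> ~~ sorted leq u.
Proof.
move=> fd; have := fd d.+1; rewrite ltnn => /negbT; apply: contra => su.
exact: take_sorted.
Qed.

Lemma first_run_drop u d j : first_run u d -> j < d -> first_run (drop j u) (d - j).
Proof.
move=> fd jd x; rewrite take_drop; case: leqP => xd.
  by apply: drop_sorted; rewrite fd; lia.
apply/negP => sj; have := fd (x + j).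
have -> : (x + j <= d) = false by lia.
move/negbT/negP; apply; apply/(sortedP 0) => i.
rewrite size_take_min => isz.
(* The increasing factors [take d u] and [take x (drop j u)] overlap because [j < d], so each
   adjacent pair lies inside one of them. Their union would then extend the first run beyond [d]. *)
have [id|di] := ltnP i.+1 d.
  have := fd d; rewrite leqnn => /(sortedP 0)/(_ i).
  rewrite size_take_min (@nth_take d _ 0 i.+1) ?(@nth_take d _ 0 i) ?(ltnW id) //.
  rewrite !nth_take; [|lia|lia]. move=> h; apply: h; lia.
have /(sortedP 0)/(_ (i - j)) := sj.
rewrite size_drop size_take_min !nth_drop.
by (have -> : j + (i - j).+1 = i.+1 by lia); (have -> : j + (i - j) = i by lia); apply; lia.
Qed.

Variables n m : nat.
Implicit Types (M X : mset n) (u : seq nat).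

(** A nonempty [cs] requires a descent, so only [cs = [::]] remains, and its sum condition reads
    [msum M = 0]. *)
Lemma run_sum_sorted M u : size u = msum M + m -> sorted leq u ->
  run_sum m M u = (mempty M)%:R%R.
Proof.
move=> su sortu; rewrite /run_sum big_mkcond sum_comps /= sortu mulr1 add0n.
rewrite [X in (_ + X)%R]big1 ?addr0.
  by rewrite su mempty_msum; case: eqVneq; case: eqVneq => //; lia.
move=> x _; apply: big1 => cs _; rewrite take_sorted //= take_sorted //= mulr0.
by case: ifP.
Qed.

(** Maximality of runs leaves [d] as the only possible first entry of [cs]. *)
Lemma run_sum_first_run M u d : first_run u d ->
  run_sum m M u =
  (\sum_(X in below_by M d) mcoef M X * run_sum m X (drop d u))%R.
Proof.
move=> fd; have du := first_run_lt_size fd (first_run_unsorted fd).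
have d0 := first_run_gt0 fd.
rewrite /run_sum big_mkcond sum_comps /= (negPf (first_run_unsorted fd)) mulr0 if_same add0r.
rewrite (eq_bigr (fun x => if x == d then
   \sum_(cs <- comps (size u - d) | (sumn cs + m == size u - d)%N)
      vdec M (d :: cs) * (pexact cs (drop d u))%:R else 0)%R); last first.
  move=> x _; case: eqP => [->|xd]; last first.
    apply: big1 => cs _; rewrite !fd; case: ifP => // _.
    have -> : (x <= d) && (~~ (x < d) && pexact cs (drop x u)) = false by lia.
    by rewrite mulr0.
  rewrite [RHS]big_mkcond; apply: eq_bigr => cs _.
  rewrite !fd leqnn ltnn /=.
  by have -> : (d + sumn cs + m == size u) = (sumn cs + m == size u - d) by lia.
rewrite -big_mkcond big_nat1_eq ifT; last lia.
rewrite size_drop /=; under eq_bigr do rewrite mulr_suml.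
rewrite exchange_big /=; apply: eq_bigr => X _; rewrite mulr_sumr.
by apply: eq_bigr => cs _; rewrite mulrA.
Qed.

(* The multisets between [X] and [M] that meet the first run of [u] cancel,
   being weighted by the Moebius function [mcoef]. *)
Lemma run_sumE M u : size u = msum M + m ->
  (\sum_(X | mle X M) (sorted leq (take (msum M - msum X) u))%:R *
      run_sum m X (drop (msum M - msum X) u) = (sorted leq u)%:R)%R.
Proof.
move=> su; case: (boolP (sorted leq u)) => [sortu|/first_runP[d fd]].
  (* On an increasing word only the empty submultiset contributes. *)
  rewrite (eq_bigr (fun X => (mempty X)%:R)%R); last first.
    move=> X XM; have := msum_le XM => h.
    rewrite take_sorted // mul1r run_sum_sorted ?drop_sorted // size_drop; lia.
  have E0 : mempty ([ffun=> ord0] : mset n) by apply/forallP => e; rewrite ffunE.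
  rewrite (bigD1 [ffun=> ord0]) /=; last by apply/mleP => e; rewrite ffunE.
  rewrite E0 big1 ?addr0 // => X /andP[_]; case: (boolP (mempty X)) => // /forallP h.
  by case/eqP; apply/ffunP => e; apply: val_inj; rewrite ffunE; apply/eqP; apply: h.
have d0 := first_run_gt0 fd.
(* Let [x = msum M - msum X]. If [x < d], the rest of the first run has length [d - x] and is
   removed from [X], leaving [Y]; if [x = d], only [Y = X] occurs, with weight 1; if [x > d], both
   sides vanish. All three cases take the same form, with [Y] ranging over [below_by M d]. *)
rewrite (eq_bigr (fun X => \sum_(Y in below_by M d | mle Y X)
    mcoef X Y * run_sum m Y (drop d u))%R); last first.
  move=> X XM; have hX := msum_le XM; rewrite fd.
  have [lt|gt|eqd] := ltngtP (msum M - msum X) d.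
  - rewrite mul1r (run_sum_first_run _ (first_run_drop fd lt)).
    apply: eq_big => Y.
      rewrite !inE; case: (boolP (mle Y X)) => YX; last by rewrite andbF.
      by rewrite (mle_trans YX XM) /= andbT; lia.
    move=> _; rewrite drop_drop; congr (_ * run_sum _ _ (drop _ _))%R; lia.
  - rewrite mul0r big_pred0 // => Y; rewrite inE; apply/negbTE/negP.
    case/andP=> /andP[YM /eqP e] YX; have := msum_le YX; lia.
  rewrite eqd mul1r (big_pred1 X) ?mcoef_refl ?mul1r // => Y; rewrite inE /=.
  apply/idP/eqP => [/andP[/andP[_ /eqP e] YX]|->].
    by apply: (mle_eq YX); lia.
  by rewrite XM mle_refl /= andbT; lia.
rewrite (exchange_big_dep [in below_by M d]) /=; last by move=> X Y _ /andP[].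
apply: big1 => Y; rewrite inE => /andP[YM /eqP e].
rewrite -mulr_suml (eq_bigl (fun X => mle Y X && mle X M)); last first.
  by move=> X; rewrite /= YM e eqxx /= andbC.
(* The sum over [X] vanishes unless [Y = M], which is impossible because [Y] falls short of [M] by
   [d > 0]. *)
rewrite sum_mcoef //; case: eqP => [eYM|]; last by rewrite mul0r.
by move: e; rewrite eYM; lia.
Qed.

(** Both sums satisfy the same triangular system, in which the term [X = M] has coefficient 1; the
    other terms agree by induction on [msum]. *)
Lemma refine_sum_run_sum M u : size u = msum M + m ->
  refine_sum M u = run_sum m M u.
Proof.
have [k] := ubnP (msum M); elim: k M u => // k IH M u hk su.
have := refine_sumE su; rewrite -(run_sumE su).
rewrite (bigD1 M) ?mle_refl // [in RHS](bigD1 M) ?mle_refl //= subnn take0 drop0 !mul1r.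
rewrite (eq_bigr (fun X => (sorted leq (take (msum M - msum X) u))%:R *
      run_sum m X (drop (msum M - msum X) u))%R); first by move/addIr.
move=> X /andP[XM nXM]; congr (_ * _)%R.
have lt : msum X < msum M.
  by rewrite ltn_neqAle msum_le // andbT; apply: contra nXM => /eqP/(mle_eq XM)/eqP.
by apply: IH; rewrite ?size_drop; lia.
Qed.

End Runs.

(** * The order on pointed integer partitions *)

Lemma perm_map_lift (S T : eqType) (f : S -> T) s t :
  perm_eq (map f s) t -> exists2 s', perm_eq s s' & map f s' = t.
Proof.
elim: t s => [|x t IH] s p.
  by exists [::] => //; move/perm_size: p; rewrite size_map => /size0nil ->.
have /mapP[y ys xy] : x \in map f s by rewrite (perm_mem p) mem_head.
have ps := perm_to_rem ys.
have [|s' p' e'] := IH (rem y s).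
  rewrite -(perm_cons x) -(permPr p) xy -map_cons perm_sym; exact: perm_map.
exists (y :: s'); last by rewrite /= e' xy.
by rewrite (permPl ps) perm_cons.
Qed.

Section PointedIntegerPartitions.

Implicit Types a b c : pip.

(** A closed form of the order: the groups in [ls] are merged into the parts of [b], and [r] is
    absorbed by the pointed part. *)
Definition splits a b : Prop := exists ls r,
  [/\ perm_eq a.1 (flatten ls ++ r), map sumn ls = b.1 & b.2 = sumn r + a.2].

Lemma splits_refl a : splits a a.
Proof.
exists [seq [:: x] | x <- a.1], [::]; rewrite cats0 flatten_seq1; split => //.
by rewrite -map_comp -[RHS]map_id; apply: eq_map => x /=; rewrite addn0.
Qed.

Lemma splits_eqv a b c : splits a b -> pip_eqv b c -> splits a c.
Proof.
case=> ls [r [p e er]] [pc ec]; rewrite -e in pc.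
have [ls' pl el] := perm_map_lift pc.
exists ls', r; split; rewrite -?ec //; apply: perm_trans p _.
by rewrite perm_cat2r perm_flatten.
Qed.

Lemma splits_cover a b c : splits a b -> pip_cover b c -> splits a c.
Proof.
move=> sab; case=> [[x [y [r [pb [pc ec]]]]]|[x [r [pb [pc ec]]]]].
  have [] : splits a ([:: x, y & r], b.2) by apply: splits_eqv sab _.
  move=> [|l1 [|l2 ls]] [t [p /= e et]] //; case: e => e1 e2 e3.
  apply: (@splits_eqv _ ((x + y) :: r, c.2)); last by split; rewrite //= perm_sym.
  exists ((l1 ++ l2) :: ls), t; split=> /=.
    by rewrite -(catA l1 l2).
    by rewrite sumn_cat e1 e2 e3.
  by rewrite ec.
have [] : splits a (x :: r, b.2) by apply: splits_eqv sab _.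
move=> [|l1 ls] [t [p /= e et]] //; case: e => e1 e2.
apply: (@splits_eqv _ (r, c.2)); last by split; rewrite //= perm_sym.
exists ls, (l1 ++ t); split => //=.
  by rewrite (permPl p) /= perm_sym perm_catCA catA.
by rewrite ec et sumn_cat e1 addnA.
Qed.

Lemma pip_le_splits a b : pip_le a b -> splits a b.
Proof.
move=> ab; have := splits_refl a; elim: ab {1 3}a => [x y [h|h] z sz|x z //|x y z _ h1 _ h2 w sw].
- exact: splits_cover h.
- exact: splits_eqv h.
by apply: h2; apply: h1.
Qed.

Lemma pip_le_perm s t k : perm_eq s t -> pip_le (s, k) (t, k).
Proof. by move=> p; apply: rt_step; right. Qed.

Lemma pip_le_point s r k : pip_le (s ++ r, k) (s, sumn r + k).
Proof.
elim: r k => [|x r IH] k; first by rewrite cats0; apply: rt_refl.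
apply: (@rt_trans _ _ _ (s ++ r, x + k)).
  apply: rt_step; left; right; exists x, (s ++ r); split=> //=.
  by rewrite -cat1s perm_catCA.
by have := IH (x + k); rewrite addnA (addnC _ x).
Qed.

(** Groups must be nonempty: an empty one would create a part 0, which no cover produces. In
    [splits_pip_le] this follows from positivity of the parts of [b]. *)
Lemma pip_le_merge ls t k : all (fun l => l != [::]) ls ->
  pip_le (flatten ls ++ t, k) (map sumn ls ++ t, k).
Proof.
elim: ls t => [|l ls IH] t /=; first by move=> _; apply: rt_refl.
case/andP; case: l => // x l _ hls.
apply: (@rt_trans _ _ _ ((x + sumn l) :: flatten ls ++ t, k)).
  rewrite -catA /=; elim: l x => [|y l IHl] x /=; first by rewrite addn0; apply: rt_refl.
  apply: (@rt_trans _ _ _ ((x + y) :: l ++ flatten ls ++ t, k)); last by rewrite addnA.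
  by apply: rt_step; left; left; exists x, y, (l ++ flatten ls ++ t).
apply: (@rt_trans _ _ _ (flatten ls ++ (x + sumn l) :: t, k)).
  by apply: pip_le_perm; rewrite -(cat1s _ (flatten ls ++ t)) perm_catCA.
apply: (@rt_trans _ _ _ (map sumn ls ++ (x + sumn l) :: t, k)); first exact: IH.
apply: pip_le_perm.
by rewrite -cat1s perm_catCA.
Qed.

Lemma splits_pip_le a b : all (fun e => 0 < e) b.1 -> splits a b -> pip_le a b.
Proof.
case: a b => a k [b j] /= pos [ls [r [/= p e ->]]].
apply: (@rt_trans _ _ _ (flatten ls ++ r, k)); first exact: pip_le_perm.
apply: (@rt_trans _ _ _ (flatten ls, sumn r + k)); first exact: pip_le_point.
have := @pip_le_merge ls [::] (sumn r + k); rewrite !cats0 e; apply.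
by move: pos; rewrite -e all_map; apply: sub_all => -[].
Qed.

End PointedIntegerPartitions.

(** * The order on pointed set partitions *)

Section PointedSetPartitions.

Variable n : nat.
Implicit Types (p q : psp n) (A B D E : {set 'I_n}) (l : seq {set 'I_n}).

Lemma psp_leP p q : reflect
  ((forall B, B \in p.1 -> B \subset q.2 \/ exists2 B', B' \in q.1 & B \subset B') /\
   p.2 \subset q.2) (psp_le p q).
Proof.
apply: (iffP andP) => -[h Z]; split=> //.
  move=> B Bp; have /forall_inP/(_ B Bp)/orP[] := h; first by left.
  by case/exists_inP=> B' ? ?; right; exists B'.
apply/forall_inP => B Bp; have [->//|[B' ? ?]] := h B Bp.
by apply/orP; right; apply/exists_inP; exists B'.
Qed.

Lemma psp_le_refl p : psp_le p p.
Proof. by apply/psp_leP; split=> // B Bp; right; exists B. Qed.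

Lemma psp_le_trans : transitive (@psp_le n).
Proof.
move=> q p r /psp_leP[h1 z1] /psp_leP[h2 z2]; apply/psp_leP; split; last exact: subset_trans z2.
move=> B /h1[Bz|[B' /h2[B'z|[B'' B''r sB']] sB]]; first by left; apply: subset_trans z2.
  by left; apply: subset_trans B'z.
by right; exists B'' => //; apply: subset_trans sB'.
Qed.

Section Valid.

Variable p : psp n.
Hypothesis vp : psp_valid p.

Lemma psp_block_neq0 A : A \in p.1 -> exists x, x \in A.
Proof.
move=> Ap; have /and3P[_ _ n0] := vp.
by apply/set0Pn; apply: contra n0 => /eqP <-.
Qed.

Lemma psp_block_eq A B x : A \in p.1 -> B \in p.1 -> x \in A -> x \in B -> A = B.
Proof.
have /and3P[_ tI _] := vp => Ap Bp xA xB.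
by rewrite -(def_pblock tI Ap xA) -(def_pblock tI Bp xB).
Qed.

Lemma psp_block_notin A x : A \in p.1 -> x \in A -> x \notin p.2.
Proof.
have /and3P[/eqP cov _ _] := vp => Ap xA.
rewrite -in_setC -cov; apply/bigcupP; by exists A.
Qed.

Lemma psp_blockP x : x \notin p.2 -> exists2 A, A \in p.1 & x \in A.
Proof.
have /and3P[/eqP cov _ _] := vp.
by rewrite -in_setC -cov => /bigcupP[A ? ?]; exists A.
Qed.

(** [E] is a union of blocks of [p], up to elements of the zero block. *)
Definition psp_closed E := [forall A in p.1, (A \subset E) || [disjoint A & E]].

Lemma psp_closedP E : reflect
  (forall A x, A \in p.1 -> x \in A -> x \in E -> A \subset E) (psp_closed E).
Proof.
apply: (iffP forall_inP) => h.
  move=> A x Ap xA xE; case/orP: (h A Ap) => // dA.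
  by have := disjointFr dA xA; rewrite xE.
move=> A Ap; have [//|dA /=] := boolP (A \subset E).
rewrite disjoint_subset; apply/subsetP => x xA; rewrite inE /=.
by apply: contra dA => xE; apply: h xE.
Qed.

Lemma psp_closed_partition E : psp_closed E ->
  partition [set A in p.1 | A \subset E] (E :\: p.2).
Proof.
move=> /psp_closedP cE; have /and3P[_ tI n0] := vp; apply/and3P; split.
- apply/eqP/setP => x; rewrite inE; apply/bigcupP/andP.
    case=> A; rewrite inE => /andP[Ap sA] xA.
    by rewrite (psp_block_notin Ap xA) (subsetP sA).
  case=> /psp_blockP[A Ap xA] xE; exists A => //.
  by rewrite inE Ap (cE A x).
- by apply: trivIsetS tI; apply/subsetP => A; rewrite inE => /andP[].
by rewrite inE negb_and n0.
Qed.

Lemma sumn_psp_blocks E : psp_closed E ->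
  sumn [seq #|A| | A : {set 'I_n} <- enum p.1 & A \subset E] = #|E :\: p.2|.
Proof.
move=> cE; rewrite (card_partition (psp_closed_partition cE)) sumnE big_map big_filter.
by rewrite big_enum_cond; apply: eq_bigl => A; rewrite inE.
Qed.

End Valid.

Lemma psp_le_anti p q : psp_valid p -> psp_valid q -> psp_le p q -> psp_le q p -> p = q.
Proof.
have half p' q' : psp_valid p' -> psp_valid q' -> psp_le p' q' -> psp_le q' p' -> p'.1 \subset q'.1.
  move=> vp vq /psp_leP[h1 z1] /psp_leP[h2 z2]; apply/subsetP => A Ap.
  have Z : p'.2 = q'.2 by apply/eqP; rewrite eqEsubset z1.
  have [x xA] := psp_block_neq0 vp Ap; have xZ := psp_block_notin vp Ap xA.
  have [/subsetP/(_ x xA)|[B Bq AB]] := h1 A Ap; first by rewrite -Z (negPf xZ).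
  have xB := subsetP AB x xA.
  have [/subsetP/(_ x xB)|[A' A'p BA']] := h2 B Bq; first by rewrite (negPf xZ).
  have xA' := subsetP BA' x xB.
  have E := psp_block_eq vp Ap A'p xA xA'.
  by have -> : A = B; [apply/eqP; rewrite eqEsubset AB E|].
move=> vp vq le1 le2.
have E1 : p.1 = q.1 by apply/eqP; rewrite eqEsubset !half.
have E2 : p.2 = q.2.
  by have /psp_leP[_ z1] := le1; have /psp_leP[_ z2] := le2; apply/eqP; rewrite eqEsubset z1.
by case: p q E1 E2 {vp vq le1 le2} => [a b] [c d] /= -> ->.
Qed.

Lemma psp_le_closed p q : psp_valid p -> psp_valid q -> psp_le p q ->
  psp_closed p q.2 /\ {in q.1, forall B, psp_closed p B}.
Proof.
move=> vp vq /psp_leP[h z]; split.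
  apply/psp_closedP => A x Ap xA xq; have [//|[B Bq /subsetP/(_ x xA) xB]] := h A Ap.
  by have := psp_block_notin vq Bq xB; rewrite xq.
move=> B Bq; apply/psp_closedP => A x Ap xA xB.
have [/subsetP/(_ x xA) xq|[B' B'q AB']] := h A Ap.
  by have := psp_block_notin vq Bq xB; rewrite xq.
by rewrite (psp_block_eq vq Bq B'q xB) // (subsetP AB').
Qed.

Lemma psp_type_pos p : psp_valid p -> all (fun e => 0 < e) (psp_type p).1.
Proof.
move=> vp; apply/allP => y /mapP[A]; rewrite mem_enum => Ap ->.
by rewrite card_gt0; apply/set0Pn; apply: psp_block_neq0 Ap.
Qed.

(** Group the blocks of [p] according to the block of [q] containing them; those inside the zero
    block of [q] account for the growth of the pointed part. *)
Lemma psp_le_type p q : psp_valid p -> psp_valid q -> psp_le p q ->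
  pip_le (psp_type p) (psp_type q).
Proof.
move=> vp vq le; have [cz cB] := psp_le_closed vp vq le.
have /psp_leP[h z] := le.
apply: splits_pip_le; first exact: psp_type_pos.
pose blocks E := [seq A : {set 'I_n} <- enum p.1 | A \subset E].
have mb E A : (A \in blocks E) = (A \subset E) && (A \in p.1) by rewrite mem_filter mem_enum.
exists [seq [seq #|A| | A : {set 'I_n} <- blocks B] | B : {set 'I_n} <- enum q.1],
  [seq #|A| | A : {set 'I_n} <- blocks q.2]; split.
- rewrite /= (map_comp (map _)) -map_flatten -map_cat; apply: perm_map.
  have -> : flatten [seq blocks B | B : {set 'I_n} <- enum q.1] =
      [seq A | B : {set 'I_n} <- enum q.1, A : {set 'I_n} <- blocks B].
    by congr flatten; apply: eq_map => B; rewrite map_id.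
  apply: uniq_perm; first exact: enum_uniq.
    rewrite cat_uniq filter_uniq ?enum_uniq // andbT; apply/andP; split.
      apply: allpairs_uniq_in; first exact: enum_uniq.
        by move=> B _; rewrite filter_uniq ?enum_uniq.
      move=> B A B' A' Bq AB B'q AB' eA; subst A'; split=> //.
      move: Bq AB B'q AB'; rewrite !mem_enum !mb.
      move=> Bq /andP[AB Ap] B'q /andP[AB' _].
      have [x xA] := psp_block_neq0 vp Ap.
      by apply: (psp_block_eq vq Bq B'q (subsetP AB x xA) (subsetP AB' x xA)).
    apply/hasPn => A; rewrite mb => /andP[Az Ap].
    apply/negP => /allpairsPdep[B [A' []]]; rewrite mem_enum mb.
    move=> Bq /andP[AB _] eA; subst A'; have [x xA] := psp_block_neq0 vp Ap.
    by have := psp_block_notin vq Bq (subsetP AB x xA); rewrite (subsetP Az).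
  move=> A; rewrite mem_cat mb mem_enum; apply/idP/orP.
    move=> Ap; have [Az|[B Bq AB]] := h A Ap; first by right; rewrite Az.
    by left; apply/allpairsPdep; exists B, A; rewrite mem_enum mb AB.
  case=> [/allpairsPdep[B [A' []]]|/andP[]//]; rewrite mem_enum mb.
  by move=> Bq /andP[AB Ap] ->.
- rewrite -map_comp; apply/eq_in_map => B; rewrite mem_enum => Bq /=.
  rewrite sumn_psp_blocks ?cB //; congr #|pred_of_set _|; apply/setDidPl.
  rewrite disjoint_subset; apply/subsetP => x xB; rewrite inE /=.
  by apply: contra (psp_block_notin vq Bq xB); apply: (subsetP z).
by rewrite /= sumn_psp_blocks // cardsD (setIidPr z) subnK // subset_leq_card.
Qed.

Definition psp_of l : psp n := ([set B in l], ~: cover [set B in l]).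

Lemma ops_disjoint D l A B x : l \in ops D -> A \in l -> B \in l ->
  x \in A -> x \in B -> A = B.
Proof.
rewrite mem_ops => /and3P[_ _]; elim: l => //= C l IH /andP[/allP dC pw].
rewrite !inE => /predU1P[->|Al] /predU1P[->|Bl] // xA xB.
- by have := disjointFr (dC B Bl) xA; rewrite xB.
- by have := disjointFr (dC A Al) xB; rewrite xA.
exact: IH.
Qed.

Lemma ops_list_uniq D l : l \in ops D -> uniq l.
Proof.
rewrite mem_ops => /and3P[+ _]; elim: l => //= C l IH /andP[C0 l0] /andP[/allP dC pw].
rewrite IH // andbT; apply: contra C0 => /dC; by rewrite -setI_eq0 setIid.
Qed.

Lemma psp_of_valid D l : l \in ops D -> psp_valid (psp_of l).
Proof.
move=> lo; apply/and3P; split; rewrite /= ?setCK //.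
  apply/trivIsetP => A B; rewrite !inE => Al Bl; apply: contraR.
  rewrite -setI_eq0 => /set0Pn[x]; rewrite inE => /andP[xA xB].
  by apply/eqP; apply: ops_disjoint lo Al Bl xA xB.
by rewrite inE; move: lo; rewrite mem_ops => /and3P[/allP h _ _]; apply/negP => /h; rewrite eqxx.
Qed.

Lemma psp_of_type D l : l \in ops D ->
  pip_eqv (psp_type (psp_of l)) ([seq #|B| | B : {set 'I_n} <- l],
    n - sumn [seq #|B| | B : {set 'I_n} <- l]).
Proof.
move=> lo.
have pl : perm_eq (enum [set B in l]) l.
  apply: uniq_perm; rewrite ?enum_uniq ?(ops_list_uniq lo) // => B.
  by rewrite mem_enum inE.
split; first by apply: perm_map.
have := psp_of_valid lo; rewrite /psp_valid /= setCK => /card_partition e.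
rewrite cardsCs setCK card_ord e sumnE big_map -(perm_big _ pl) big_enum /=.
by [].
Qed.

(** The fibre of [psp_of] over [p] consists of the orderings of its blocks, whence the factorial in
    [ordered_sign]. *)
Lemma psp_of_perm p : psp_valid p ->
  perm_eq [seq l <- ops [set: 'I_n] | psp_of l == p] (permutations (enum p.1)).
Proof.
move=> vp; apply: uniq_perm; rewrite ?filter_uniq ?ops_uniq ?permutations_uniq //.
move=> l; rewrite mem_filter mem_permutations; apply/andP/idP.
  case=> /eqP <- lo; apply: uniq_perm; rewrite ?enum_uniq ?(ops_list_uniq lo) // => B.
  by rewrite mem_enum inE.
move=> pl; have E : [set B in l] = p.1.
  by apply/setP => B; rewrite inE (perm_mem pl) mem_enum.
split.
  have /and3P[/eqP cov _ _] := vp.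
  by rewrite /psp_of E cov setCK; case: (p).
rewrite mem_ops; apply/and3P; split.
- apply/allP => B; rewrite (perm_mem pl) mem_enum => /(psp_block_neq0 vp) ?.
  by apply/set0Pn.
- by apply/allP => B _; apply: subsetT.
have ul : uniq l by rewrite (perm_uniq pl) enum_uniq.
move: ul; rewrite uniq_pairwise; apply: (sub_in_pairwise (P := [in l])); last exact/allP.
move=> A B /=; rewrite !(perm_mem pl) !mem_enum => Ap Bp; apply: contraR.
rewrite -setI_eq0 => /set0Pn[x]; rewrite inE => /andP[xA xB].
by apply/eqP; apply: (psp_block_eq vp Ap Bp xA xB).
Qed.

Definition ordered_sign p : int := ((-1) ^+ #|p.1| * (#|p.1|`!)%:R)%R.

Lemma sum_ordered_sign (Q : pred (psp n)) :
  (\sum_(p | psp_valid p && Q p) ordered_sign p =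
   \sum_(l <- ops [set: 'I_n] | Q (psp_of l)) (-1) ^+ size l)%R.
Proof.
rewrite [RHS]big_seq_cond [RHS](partition_big psp_of (fun p => psp_valid p && Q p)) /=; last first.
  by move=> l /andP[lo ->]; rewrite (psp_of_valid lo).
apply: eq_bigr => p /andP[vp Qp].
rewrite (eq_bigl (fun l => (l \in ops [set: 'I_n]) && (psp_of l == p))); last first.
  by move=> l /=; case: eqP => [->|]; rewrite ?Qp ?andbT ?andbF.
rewrite -big_seq_cond -big_filter (perm_big _ (psp_of_perm vp)) /=.
rewrite (eq_big_seq (fun _ => (-1) ^+ #|p.1|)%R); last first.
  by move=> l; rewrite mem_permutations => /perm_size ->; rewrite -cardE.
by rewrite big_const_seq count_predT size_permutations ?enum_uniq // -cardE iter_addr_0 /ordered_sign mulr_natr.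
Qed.

Lemma psp_le_of p D l : psp_valid p -> l \in ops D ->
  psp_le p (psp_of l) = all (fun B => psp_closed p B && [disjoint B & p.2]) l.
Proof.
move=> vp lo; have vq := psp_of_valid lo; apply/idP/allP.
  move=> le B Bl; have [_ cB] := psp_le_closed vp vq le.
  rewrite cB ?inE //=; have /psp_leP[_ z] := le.
  rewrite disjoint_sym disjoint_subset; apply: subset_trans z _.
  apply/subsetP => x; rewrite !inE; apply: contra => xB.
  by apply/bigcupP; exists B; rewrite ?inE.
move=> h; apply/psp_leP; split=> [A Ap|]; last first.
  apply/subsetP => x xp; rewrite inE; apply/bigcupP => -[B]; rewrite inE => /h/andP[_ dB] xB.
  by have := disjointFr dB xB; rewrite xp.
have [/existsP[B /andP[Bl AB]]|/existsPn nB] := boolP [exists B, (B \in l) && ~~ [disjoint A & B]].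
  right; exists B; first by rewrite inE.
  have /andP[/psp_closedP cB _] := h B Bl; move: AB; rewrite -setI_eq0 => /set0Pn[x].
  by rewrite inE => /andP[xA xB]; apply: cB xB.
left; apply/subsetP => x xA; rewrite inE; apply/bigcupP => -[B]; rewrite inE => Bl xB.
by have := nB B; rewrite Bl negbK /= => dA; have := disjointFr dA xA; rewrite xB.
Qed.

(** Induction on [#|D|], splitting off the first block [B]. What follows [B] sums to 0 unless
    [D :\: B] lies in the zero block. Since [B] avoids the zero block, this leaves one candidate for
    [B], whose term -1 cancels the empty list. *)
Lemma sum_closed_ops p D : psp_valid p -> psp_closed p D ->
  (\sum_(l <- ops D | all (fun B => psp_closed p B && [disjoint B & p.2]) l)
      (-1) ^+ size l = (D \subset p.2)%:R :> int)%R.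
Proof.
move=> vp; have [k] := ubnP #|D|; elim: k D => // k IH D hk /psp_closedP cD.
rewrite big_mkcond sum_ops /=.
rewrite (eq_bigr (fun B => - (psp_closed p B && [disjoint B & p.2] && (D :\: B \subset p.2))%:R)%R);
  last first.
  move=> B /andP[B0 BD]; case: (boolP (psp_closed p B)) => cB /=; last by rewrite big1 ?oppr0.
  case: [disjoint B & p.2] => /=; last by rewrite big1 ?oppr0.
  rewrite -big_mkcond /=; under eq_bigr do rewrite exprS.
  rewrite -mulr_sumr IH ?mulN1r //; first exact: leq_trans (card_setD_lt B0 BD) _.
  apply/psp_closedP => A x Ap xA; rewrite inE => /andP[xB xD].
  rewrite subsetD (cD A x) //= disjoint_subset; apply/subsetP => y yA; rewrite inE /=.
  apply: contra xB => yB; exact: (subsetP (elimT (psp_closedP p B) cB A y Ap yA yB)).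
have [Dp|nDp] := boolP (D \subset p.2).
  rewrite big1 ?addr0 // => B /andP[/set0Pn[x xB] BD].
  case: (boolP [disjoint B & p.2]) => [dB|]; last by rewrite andbF.
  by have := disjointFr dB xB; rewrite (subsetP Dp) // (subsetP BD).
(* The only surviving first block is all of [D] outside the zero block. *)
rewrite (bigD1 (D :\: p.2)) /=; last by rewrite setD_eq0 nDp subsetDl.
rewrite big1 ?addr0.
  have -> : psp_closed p (D :\: p.2).
    apply/psp_closedP => A x Ap xA; rewrite inE => /andP[_ xD].
    rewrite subsetD (cD A x) //= disjoint_subset; apply/subsetP => y yA.
    by rewrite inE /=; apply: psp_block_notin yA.
  have -> : [disjoint D :\: p.2 & p.2].
    by rewrite disjoint_subset; apply/subsetP => x; rewrite !inE => /andP[].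
  have -> : D :\: (D :\: p.2) \subset p.2 by rewrite setDDr setDv set0U subsetIr.
  by rewrite subrr.
move=> B /andP[/andP[_ BD] nB]; case: (boolP [disjoint B & p.2]) => [dB|]; last by rewrite andbF oppr0.
case: (boolP (D :\: B \subset p.2)) => [sB|]; last by rewrite andbF oppr0.
case/eqP: nB; apply/eqP; rewrite eqEsubset subsetD BD dB /=.
apply/subsetP => x; rewrite inE => /andP[xp xD].
by apply: contraR xp => xB; apply: (subsetP sB); rewrite inE xB.
Qed.

Lemma sum_above p : psp_valid p ->
  (\sum_(q | psp_valid q && psp_le p q) ordered_sign q = (p == psp_top n)%:R)%R.
Proof.
move=> vp; rewrite sum_ordered_sign big_seq_cond.
rewrite (eq_bigl (fun l => (l \in ops [set: 'I_n]) &&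
   all (fun B => psp_closed p B && [disjoint B & p.2]) l)); last first.
  by move=> l; case: (boolP (l \in _)) => // lo; rewrite (psp_le_of vp lo).
rewrite -big_seq_cond sum_closed_ops //; last by apply/psp_closedP => *; apply: subsetT.
congr (_%:R)%R; congr nat_of_bool; rewrite subTset; apply/eqP/eqP => [e|->//].
have: p.1 = set0.
  apply/setP => A; rewrite inE; apply/negP => Ap; have [x xA] := psp_block_neq0 vp Ap.
  by have := psp_block_notin vp Ap xA; rewrite e inE.
by rewrite /psp_top; case: (p) e => /= a b -> ->.
Qed.

End PointedSetPartitions.

Lemma sum_option (T : finType) (V : nmodType) (F : option T -> V) (Q : pred (option T)) :
  (\sum_(o | Q o) F o = (if Q None then F None else 0) + \sum_(x | Q (Some x)) F (Some x))%R.
Proof.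
rewrite big_mkcond /= (perm_big (None :: [seq Some x | x : T])).
  by rewrite big_cons big_image -big_mkcond.
apply: uniq_perm; rewrite ?index_enum_uniq //=.
  rewrite map_inj_uniq ?enum_uniq ?andbT => [|x y [] //].
  by apply/negP => /mapP[].
move=> [x|]; rewrite mem_index_enum ?inE //=; apply/esym.
by apply/mapP; exists x; rewrite ?mem_enum.
Qed.

Lemma mu_PiF_ops n (x : pip) : sumn x.1 + x.2 = n ->
  (mu_PiF n x = - \sum_(l <- ops [set: 'I_n] |
     `[< in_filter x ([seq #|B| | B : {set 'I_n} <- l],
          n - sumn [seq #|B| | B : {set 'I_n} <- l])%N >]) (-1) ^+ size l)%R.
Proof.
move=> sx; pose F (p : psp n) := `[< in_filter x (psp_type p) >].
have Ftop : F (psp_top n).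
  apply/asboolP; apply: splits_pip_le => /=.
    by apply/allP => y /mapP[A]; rewrite mem_enum inE.
  exists [::], x.1; split=> //=; first by rewrite enum_set0.
  by rewrite cardsT card_ord sx.
have vtop : psp_valid (psp_top n).
  by apply/and3P; rewrite /= setCT /cover big_set0 eqxx inE; split=> //; apply/trivIsetP => A B; rewrite inE.
(* The value at the adjoined minimum is chosen so that the total sum of [h] is 0. *)
pose h (o : option (psp n)) : int :=
  if o is Some p then ordered_sign p else (- \sum_(p | psp_valid p && F p) ordered_sign p)%R.
rewrite /mu_PiF (@mobius_dual _ _ _ _ _ _ h) //=.
- congr (- _)%R; rewrite sum_ordered_sign big_seq_cond [RHS]big_seq_cond.
  apply: eq_bigl => l; case: (boolP (l \in _)) => //= lo.
  apply/asboolP/asboolP => hx.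
    by apply: rt_trans hx _; apply: rt_step; right; apply: psp_of_type lo.
  apply: rt_trans hx _; apply: rt_step; right.
  by have [h1 h2] := psp_of_type lo; split; rewrite //= perm_sym.
- by case=> [p|] // _; apply: psp_le_refl.
- move=> [p|] [q|] //= /andP[vp _] /andP[vq _] /andP[le1 le2].
  by rewrite (psp_le_anti vp vq le1 le2).
- by move=> [p|] [q|] [r|] //= _ _ _; apply: psp_le_trans.
- exact/andP.
- move=> [p|] //= /andP[vp _]; apply/psp_leP; split; last exact: subsetT.
  by move=> B _; left; apply: subsetT.
case=> [p|] /=.
  case/andP=> vp /asboolP Fp; rewrite sum_option /= add0r.
  (* Types grow along the order, so everything above [p] is again in the filter and [sum_above]
     applies. *)
  rewrite -(sum_above vp); apply: eq_bigl => q.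
  case: (boolP (psp_valid q)) => //= vq; case: (boolP (psp_le p q)) => le; rewrite ?andbF //.
  by rewrite andbT; apply/asboolP; apply: rt_trans Fp _; apply: psp_le_type.
move=> _; rewrite sum_option /=; under [X in (_ + X)%R]eq_bigl do rewrite andbT.
by rewrite addNr.
Qed.

(** * Knapsack partitions *)

Section MultisetsOfLists.

Variable n : nat.
Implicit Types (M X U : mset n) (s t : seq nat).

(** Under this bound the parts lie between 1 and [n] and the multiplicities are at most [n], so
    [inord] in [mset_of] never returns its default. *)
Definition small s := all (fun x => 0 < x) s && (sumn s <= n).

Definition mset_of s : mset n := [ffun e : 'I_n => inord (count_mem e.+1 s)].

Definition list_of M : seq nat := flatten [seq nseq (M e) e.+1 | e : 'I_n <- enum 'I_n].

Definition mdiff M X : mset n := [ffun e : 'I_n => inord (M e - X e)].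

Lemma size_le_sumn s : all (fun x => 0 < x) s -> size s <= sumn s.
Proof. by elim: s => //= x s IH /andP[x0 /IH]; lia. Qed.

Lemma small_mem s x : small s -> x \in s -> 0 < x <= n.
Proof.
case/andP=> /allP pos le xs; rewrite (pos x xs) /=; apply: leq_trans le.
by rewrite (perm_sumn (perm_to_rem xs)) /= leq_addr.
Qed.

Lemma mset_ofE s (e : 'I_n) : small s -> mset_of s e = count_mem e.+1 s :> nat.
Proof.
case/andP=> /size_le_sumn h1 h2; rewrite ffunE inordK // ltnS.
exact: leq_trans (count_size _ _) (leq_trans h1 h2).
Qed.

Lemma mdiffE M X (e : 'I_n) : mdiff M X e = M e - X e :> nat.
Proof. by rewrite ffunE inordK // ltnS; apply: leq_trans (leq_subr _ _) _; rewrite -ltnS. Qed.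

(** The weight [w] is taken to be the identity for [msum] and constantly 1 for [msize]. *)
Lemma sum_count s (w : nat -> nat) : all (fun x => 0 < x <= n) s ->
  \sum_(e < n) w e.+1 * count_mem e.+1 s = \sum_(x <- s) w x.
Proof.
elim: s => [_|x s IH /= /andP[/andP[x0 xn] /IH {}IH]].
  by rewrite big_nil big1 // => e _; rewrite muln0.
rewrite big_cons -IH; under eq_bigr do rewrite mulnDr.
rewrite big_split /=; congr addn.
have hx : x.-1 < n by lia.
rewrite (bigD1 (Ordinal hx)) //= prednK // eqxx muln1 big1 ?addn0 // => e ne.
have -> : (x == e.+1) = false; last by rewrite muln0.
by apply: contraNF ne => /eqP xe; apply/eqP/val_inj; rewrite /= xe.
Qed.

Lemma msum_mset_of s : small s -> msum (mset_of s) = sumn s.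
Proof.
move=> sm; rewrite /msum; under eq_bigr do rewrite mset_ofE //.
by rewrite (sum_count id) ?sumnE //; apply/allP => x; apply: small_mem.
Qed.

Lemma msize_mset_of s : small s -> msize (mset_of s) = size s.
Proof.
move=> sm; rewrite /msize; under eq_bigr do rewrite mset_ofE // -[count_mem _ _]mul1n.
by rewrite (sum_count (fun=> 1)) ?sum1_size //; apply/allP => x; apply: small_mem.
Qed.

Lemma count_list_of M (e : 'I_n) : count_mem e.+1 (list_of M) = M e.
Proof.
rewrite count_flatten -map_comp sumnE big_map big_enum /= (bigD1 e) //=.
rewrite count_nseq /= eqxx mul1n big1 ?addn0 // => e' ne.
by rewrite count_nseq /= eqSS (negPf (ne : (val e' != val e))) mul0n.
Qed.

Lemma list_of_mem M x : x \in list_of M -> 0 < x <= n.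
Proof. by case/flatten_mapP => e _; rewrite mem_nseq => /andP[_ /eqP ->] /=. Qed.

Lemma sumn_list_of M : sumn (list_of M) = msum M.
Proof.
rewrite sumn_flatten -map_comp sumnE big_map big_enum /=.
by apply: eq_bigr => e _; rewrite sumn_nseq mulnC.
Qed.

Lemma small_list_of M : msum M <= n -> small (list_of M).
Proof.
by rewrite /small sumn_list_of => ->; rewrite andbT; apply/allP => x /list_of_mem/andP[].
Qed.

Lemma list_ofK M : msum M <= n -> mset_of (list_of M) = M.
Proof.
move=> le; apply/ffunP => e; apply: val_inj.
by rewrite /= mset_ofE ?small_list_of // count_list_of.
Qed.

Lemma perm_of_counts s t : {in s, forall x, 0 < x <= n} -> {in t, forall x, 0 < x <= n} ->
  (forall e : 'I_n, count_mem e.+1 s = count_mem e.+1 t) -> perm_eq s t.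
Proof.
move=> hs ht E; apply/allP => x xst; apply/eqP.
have /andP[x0 xn] : 0 < x <= n by move: xst; rewrite mem_cat => /orP[/hs|/ht].
have hx : x.-1 < n by lia.
by have := E (Ordinal hx); rewrite /= prednK.
Qed.

Lemma mdiff_le M X : mle (mdiff M X) M.
Proof. by apply/mleP => e; rewrite mdiffE leq_subr. Qed.

Lemma msum_mdiff M X : mle X M -> msum (mdiff M X) = msum M - msum X.
Proof.
move=> /mleP h; rewrite /msum -sumnB => [|e _]; last by rewrite leq_mul2l h orbT.
by apply: eq_bigr => e _; rewrite mdiffE mulnBr.
Qed.

Lemma small_perm s t : perm_eq s t -> small s = small t.
Proof. by move=> p; rewrite /small (perm_all _ p) (perm_sumn p). Qed.

Lemma small_cat s t : small (s ++ t) -> small s /\ small t.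
Proof.
by rewrite /small all_cat sumn_cat => /andP[/andP[-> ->] h]; split=> /=; lia.
Qed.

(** A chain of submultisets records what is left after each removal. The successive differences give
    the groups [ls], and the last term of the chain is [r]. *)
Lemma dec_gt0 s cs : small s ->
  0 < dec (mset_of s) cs <->
  exists ls r, perm_eq s (flatten ls ++ r) /\ map sumn ls = cs.
Proof.
elim: cs s => [|x cs IH] s sm /=.
  by split=> // _; exists [::], s; rewrite perm_refl.
split.
  rewrite lt0n sum_nat_eq0 negb_forall => /existsP[X]; rewrite negb_imply -lt0n.
  case/andP=> /andP[XM /eqP e] dX.
  have XM' := msum_le XM; rewrite msum_mset_of // in e XM'.
  have Xn : msum X <= n by apply: leq_trans XM' _; case/andP: sm.
  have [] := IH _ (small_list_of Xn); rewrite list_ofK // => /(_ dX)[ls [r [p els]]] _.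
  exists (list_of (mdiff (mset_of s) X) :: ls), r; split.
    rewrite /= -catA -(permPr (perm_cat (perm_refl _) p)).
    apply: perm_of_counts => [y|y|i]; first exact: small_mem.
      by rewrite mem_cat => /orP[]; apply: list_of_mem.
    by rewrite count_cat !count_list_of mdiffE -(mset_ofE i sm) subnK //; apply/mleP.
  rewrite /= els sumn_list_of msum_mdiff // msum_mset_of //; congr (_ :: _); lia.
case=> -[|l ls] [r [p]] //= [el els]; subst x.
rewrite -catA in p; rewrite (small_perm p) in sm.
have [sl st] := small_cat sm.
rewrite lt0n sum_nat_eq0 negb_forall; apply/existsP.
exists (mset_of (flatten ls ++ r)); rewrite negb_imply -lt0n inE.
have ss : small s by rewrite (small_perm p).
apply/andP; split; last by apply/IH => //; exists ls, r.
apply/andP; split.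
  apply/mleP => i; rewrite !mset_ofE // (seq.permP p) (count_cat _ l) leq_addl //.
by rewrite !msum_mset_of // (perm_sumn p) (sumn_cat l) addnC.
Qed.

(** A factor [coef d] vanishes once [d] exceeds 1. The exponent is a sum, of the same parity as the
    difference of sizes, so that signs multiply along a chain. *)
Lemma mcoefE M X : mle X M ->
  mcoef M X = ((-1) ^+ (msize M + msize X) * [forall e : 'I_n, (M e - X e <= 1)%N]%:R)%R.
Proof.
move=> /mleP h; case: (boolP [forall e : 'I_n, M e - X e <= 1]) => [/forallP le1|/forallPn[e ne]]; last first.
  rewrite mulr0 /mcoef (bigD1 e) //=; move: ne; rewrite -ltnNge.
  by case: (M e - X e) => [|[|d]] //= _; rewrite mul0r.
rewrite mulr1 /msize -big_split expr_sum; apply: eq_bigr => e _ /=.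
have := le1 e; have := h e => h1 h2.
have [E|E] : (M e - X e = 0 \/ M e - X e = 1)%N by lia.
  rewrite E /=; have -> : (M e + X e = (X e).*2)%N by lia.
  by rewrite -mul2n exprM sqrrN expr1n.
rewrite E /=; have -> : (M e + X e = (X e).*2.+1)%N by lia.
by rewrite exprS -mul2n exprM sqrrN expr1n mulr1.
Qed.

Lemma dec_le1 (L : mset n) M cs :
  (forall X U, mle X L -> mle U L -> msum X = msum U -> X = U) ->
  mle M L -> dec M cs <= 1.
Proof.
move=> inj; elim: cs M => //= x cs IH M ML.
have [X XM|nX] := pickP [in below_by M x]; last by rewrite big_pred0.
rewrite (big_pred1 X).
  by apply: IH; case/andP: XM => XM _; apply: mle_trans ML.
move=> Y; apply/idP/eqP => [YM|->//].
move: XM YM; rewrite !inE => /andP[XM /eqP eX] /andP[YM /eqP eY].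
by apply: inj; [exact: mle_trans ML|exact: mle_trans ML|lia].
Qed.

(** Along a chain each intermediate sign occurs twice and squares to 1, leaving the sign of [M]. The
    hypothesis on [P] makes the distinctness condition depend only on the sum removed, so it factors
    out of the count of chains. *)
Lemma vdecE (L : mset n) (P : pred nat) M cs :
  (forall M X, mle X M -> mle M L ->
     [forall e : 'I_n, M e - X e <= 1] = P (msum M - msum X)) ->
  mle M L -> sumn cs = msum M ->
  vdec M cs = ((-1) ^+ msize M * (dec M cs)%:R * (all P cs)%:R)%R.
Proof.
move=> HP; elim: cs M => [|x cs IH] M ML /= es.
  rewrite mempty_msum -es eqxx !mulr1.
  have /forallP M0 : mempty M by rewrite mempty_msum -es.
  by rewrite /msize big1 // => e _; apply/eqP.
rewrite natr_sum mulr_sumr mulr_suml; apply: eq_bigr => X.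
rewrite inE => /andP[XM /eqP eX].
rewrite mcoefE // HP // (IH X) ?(mle_trans XM) //; last lia.
have -> : msum M - msum X = x by lia.
rewrite -mulnb natrM exprD.
have E : ((-1) ^+ msize X * (-1) ^+ msize X = 1 :> int)%R.
  by rewrite -exprD addnn -mul2n exprM sqrrN expr1n.
have comb (a b c d e : int) : (b * b = 1 -> a * b * c * (b * d * e) = a * d * (c * e))%R.
  by move=> bb; transitivity (b * b * (a * d * (c * e)))%R; [ring|rewrite bb mul1r].
exact: comb E.
Qed.

(** * Submultisets of a knapsack partition *)

Section Knapsack.

Variable lam : seq nat.
Hypothesis slam : small lam.
Let L := mset_of lam.

Lemma small_mask (b : bitseq) : small (mask b lam).
Proof.
case/andP: slam => /allP pos le; apply/andP; split.
  by apply/allP => x /mem_mask; apply: pos.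
apply: leq_trans le; elim: b {pos} (lam) => [|[] b IH] [|x s] //=.
  by rewrite leq_add2l.
by apply: leq_trans (IH s) _; apply: leq_addl.
Qed.

Lemma mask_le (b : bitseq) : mle (mset_of (mask b lam)) L.
Proof.
apply/mleP => e; rewrite !mset_ofE ?small_mask //.
by apply: leq_count_subseq; apply: mask_subseq.
Qed.

Lemma mask_surj U : mle U L ->
  exists t : (size lam).-tuple bool, mset_of (mask t lam) = U.
Proof.
move=> UL; have sU : msum U <= n.
  by apply: leq_trans (msum_le UL) _; rewrite msum_mset_of //; case/andP: slam.
have [|s /subseqP[b sb ->] p] := (count_subseqP (list_of U) lam).1.
  move=> x; case: (boolP (x \in list_of U)) => [xU|/count_memPn -> //].
  have /andP[x0 xn] := list_of_mem xU.
  have hx : x.-1 < n by lia.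
  have := count_list_of U (Ordinal hx); rewrite /= prednK // => ->.
  by have := mleP _ _ UL (Ordinal hx); rewrite mset_ofE //= prednK.
exists (tcast sb (in_tuple b)); rewrite val_tcast /=.
apply/ffunP => e; apply: val_inj; rewrite /= mset_ofE ?small_mask //.
by rewrite -(seq.permP p) count_list_of.
Qed.

Lemma card_submultisets :
  #|[set M : mset n | mle M L]| = \prod_(x <- undup lam) (count_mem x lam).+1.
Proof.
have -> : #|[set M : mset n | mle M L]| = \sum_(M : mset n) \prod_(e < n) (M e <= L e : nat).
  rewrite -sum1_card [LHS]big_mkcond; apply: eq_bigr => M _; rewrite inE.
  case: (boolP (mle M L)) => [/mleP h|]; first by rewrite big1 // => e _; rewrite h.
  by move=> /forallPn[e ne]; rewrite (bigD1 e) //= (negPf ne).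
rewrite -(bigA_distr_bigA (fun (e : 'I_n) (j : 'I_n.+1) => (j <= L e : nat))).
rewrite (eq_bigr (fun e : 'I_n => (count_mem e.+1 lam).+1)); last first.
  move=> e _; rewrite -(mset_ofE e slam) -/L.
  rewrite -[RHS]card_ord -sum1_card (big_ord_widen n.+1 (fun=> 1)) // [RHS]big_mkcond.
  by apply: eq_bigr => j _; rewrite ltnS; case: leqP.
rewrite -(big_mkord xpredT (fun e => (count_mem e.+1 lam).+1)).
have -> : \prod_(0 <= e < n) (count_mem e.+1 lam).+1 = \prod_(1 <= x < n.+1) (count_mem x lam).+1.
  by rewrite big_add1.
rewrite (bigID (fun x => x \in lam)) /= [X in _ * X]big1 ?muln1; last first.
  by move=> x /count_memPn ->.
rewrite -big_filter; apply: perm_big; apply: uniq_perm; rewrite ?undup_uniq //.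
  by rewrite filter_uniq ?iota_uniq.
move=> x; rewrite mem_filter mem_undup mem_index_iota; apply/andb_idr => xl.
by have := small_mem slam xl; lia.
Qed.

Hypothesis klam : knapsack lam.

(** By [card_submultisets], the knapsack condition says that there are as many distinct sums as
    submultisets, so [msum] is injective on them. *)
Lemma knapsack_inj X U : mle X L -> mle U L -> msum X = msum U -> X = U.
Proof.
set A := [set M : mset n | mle M L].
have : uniq [seq msum M | M <- enum A].
  rewrite -[uniq _]negbK -ltn_size_undup -leqNgt size_map -cardE card_submultisets.
  rewrite -(eqP klam); apply: eq_leq; apply: perm_size; apply: uniq_perm; rewrite ?undup_uniq //.
  move=> x; rewrite !mem_undup; apply/mapP/mapP => -[].
    move=> t _ ->; exists (mset_of (mask t lam)); first by rewrite mem_enum inE mask_le.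
    by rewrite msum_mset_of ?small_mask.
  move=> Y; rewrite mem_enum inE => /mask_surj[t <-] ->.
  by exists t; rewrite ?mem_enum // msum_mset_of ?small_mask.
move=> u XL UL e.
have XA : X \in enum A by rewrite mem_enum inE.
have UA : U \in enum A by rewrite mem_enum inE.
rewrite -(nth_index X XA) -(nth_index X UA); congr nth; apply/eqP.
rewrite -(nth_uniq 0 _ _ u) ?size_map ?index_mem //.
by rewrite !(nth_map X) ?index_mem // !nth_index // e.
Qed.

(** By injectivity, every mask with the sum of [U] has [U] as its multiset, and some mask does. Its
    entries are distinct exactly when all multiplicities of [U] are at most 1. *)
Lemma distinct_summandsE M X : mle X M -> mle M L ->
  [forall e : 'I_n, M e - X e <= 1] = distinct_summands lam (msum M - msum X).
Proof.
move=> XM ML; set U := mdiff M X; have UL : mle U L := mle_trans (mdiff_le _ _) ML.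
rewrite -msum_mdiff // -/U.
have sumE (t : (size lam).-tuple bool) :
    (sumn (mask t lam) == msum U) = (mset_of (mask t lam) == U).
  rewrite -msum_mset_of ?small_mask //; apply/eqP/eqP => [|-> //].
  by apply: knapsack_inj; rewrite ?mask_le.
have uniqE (t : (size lam).-tuple bool) : mset_of (mask t lam) = U ->
    uniq (mask t lam) = [forall e : 'I_n, M e - X e <= 1].
  move=> tU; have cE (e : 'I_n) : count_mem e.+1 (mask t lam) = M e - X e.
    by rewrite -mset_ofE ?small_mask // tU mdiffE.
  apply/idP/forallP => [ut e|le1].
    by rewrite -cE count_uniq_mem // leq_b1.
  apply: count_mem_uniq => x; case: (boolP (x \in _)) => [xt|/count_memPn //].
  have hx := small_mem (small_mask t) xt.
  have hx' : x.-1 < n by lia.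
  have := le1 (Ordinal hx'); rewrite -cE /= prednK; last by case/andP: hx.
  by move=> c1; apply/eqP; rewrite eqn_leq c1 -has_count has_pred1.
have [t0 t0U] := mask_surj UL.
apply/idP/andP => [h|[_ /forallP/(_ t0)]].
  split; first by apply/existsP; exists t0; rewrite sumE t0U.
  by apply/forallP => t; rewrite sumE; apply/implyP => /eqP tU; rewrite uniqE.
by rewrite sumE t0U eqxx /= uniqE.
Qed.

End Knapsack.

End MultisetsOfLists.

(** * Descent sets of permutations *)

Section Descents.

Lemma mem_psums_cons x cs i : (i \in psums (x :: cs)) = (i == x) || (x <= i) && (i - x \in psums cs).
Proof.
have -> : psums (x :: cs) = x :: map (addn x) (psums cs).
  rewrite /psums /= take0 addn0; congr (_ :: _).
  by rewrite -[2]/(1 + 1) iotaDl -!map_comp.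
rewrite inE; congr orb; apply/mapP/andP => [[j jc ->]|[xi ic]].
  by rewrite leq_addr addKn.
by exists (i - x) => //; rewrite subnKC.
Qed.

Lemma mem_psums_bounds cs i : all (fun c => 0 < c) cs -> i \in psums cs -> 0 < i <= sumn cs.
Proof.
elim: cs i => // x cs IH i /= /andP[x0 pos]; rewrite mem_psums_cons.
case/predU1P=> [->|/andP[xi /(IH _ pos)]]; lia.
Qed.

Lemma sorted_takeP u x : x <= size u ->
  reflect (forall i, 0 < i < x -> nth 0 u i.-1 <= nth 0 u i) (sorted leq (take x u)).
Proof.
move=> xu; apply: (iffP (sortedP 0)); rewrite size_take_min (minn_idPl xu) => h.
  case=> // i /andP[_ ix]; have := h i ix; rewrite !nth_take //; exact: ltnW.
by move=> i ix; rewrite !nth_take ?(ltnW ix) //; apply: (h i.+1).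
Qed.

(** The strict inequality keeps the last piece nonempty, so every cut is an interior position where
    a descent can occur. *)
Lemma pexactP cs u : all (fun c => 0 < c) cs -> sumn cs < size u ->
  reflect (forall i, 0 < i < size u -> (nth 0 u i < nth 0 u i.-1) = (i \in psums cs))
    (pexact cs u).
Proof.
elim: cs u => [|x cs IH] u /=.
  move=> _ _; rewrite -[X in sorted _ X]take_size; apply: (iffP (sorted_takeP (leqnn _))) => h i hi.
    by rewrite ltnNge h.
  by rewrite leqNgt h.
case/andP=> x0 pos su.
have sd : sumn cs < size (drop x u) by rewrite size_drop; lia.
have xu : x <= size u by lia.
have xu1 : x < size u by lia.
apply: (iffP and3P) => [[s1 s2 s3] i /andP[i0 iu]|h].
  rewrite mem_psums_cons; have [ix|xi|->] := ltngtP i x.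
  - by rewrite /= ltnNge (sorted_takeP xu s1) // i0.
  - move/(IH _ pos sd): s3 => /(_ (i - x)); rewrite size_drop !nth_drop => <-; last lia.
    by congr (nth _ _ _ < nth _ _ _); lia.
  rewrite /=; apply: contraR s2; rewrite -leqNgt => le.
  apply/sorted_takeP => // j /andP[j0]; rewrite ltnS leq_eqVlt => /predU1P[->//|jx].
  by apply: (sorted_takeP xu s1); rewrite j0.
split.
- apply/sorted_takeP => // i /andP[i0 ix].
  by rewrite leqNgt h ?mem_psums_cons; [lia|lia].
- apply/negP => /sorted_takeP/(_ x)- /(_ xu1).
  rewrite x0 ltnSn => /(_ isT); rewrite leqNgt h ?mem_psums_cons ?eqxx //.
  by rewrite x0.
apply/(IH _ pos sd) => i; rewrite size_drop !nth_drop => hi.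
have := h (x + i); rewrite mem_psums_cons addKn leq_addr => H.
have -> : x + i.-1 = (x + i).-1 by lia.
rewrite H; last lia.
by have -> : (x + i == x) = false by lia.
Qed.

(** The last cut reaches the end of the word, where [take x u] and [take x.+1 u] coincide, yet one
    must be sorted and the other not. This matches the convention that [beta] is 0 when the pointed
    entry is 0. *)
Lemma pexact_full cs u : all (fun c => 0 < c) cs -> cs != [::] -> size u <= sumn cs ->
  pexact cs u = false.
Proof.
elim: cs u => // x cs IH u /= /andP[x0 pos] _ su.
have [e|ncs] := eqVneq cs [::].
  subst cs; rewrite /= addn0 in su.
  by rewrite (take_oversize su) (take_oversize (leq_trans su (leqnSn x))); case: sorted.
by rewrite IH ?andbF // size_drop; lia.
Qed.

End Descents.

(** * Permutations in one-line notation and [beta] *)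

Section Permutations.

Variable n : nat.
Implicit Type s : {perm 'I_n}.

Lemma size_oneline s : size (oneline s) = n.
Proof. by rewrite size_map size_enum_ord. Qed.

Lemma nth_oneline s (i : 'I_n) : nth 0 (oneline s) i = s i.
Proof. by rewrite (nth_map i) ?size_enum_ord // nth_ord_enum. Qed.

Lemma vals_setT : vals [set: 'I_n] = iota 0 n.
Proof. by rewrite /vals enum_setT -enumT val_enum_ord. Qed.

Lemma perm_onelines :
  perm_eq (permutations (vals [set: 'I_n])) [seq oneline s | s : {perm 'I_n}].
Proof.
apply: uniq_perm; first exact: permutations_uniq.
  rewrite map_inj_uniq ?enum_uniq // => s t st; apply/permP => i; apply: val_inj.
  by rewrite /= -!nth_oneline st.
move=> u; rewrite mem_permutations vals_setT; apply/idP/mapP => [pu|[s _ ->]].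
  have su : size u = n by rewrite (perm_size pu) size_iota.
  have uu : uniq u by rewrite (perm_uniq pu) iota_uniq.
  have ltu (i : 'I_n) : nth 0 u i < n.
    have : nth 0 u i \in u by rewrite mem_nth ?su.
    by rewrite (perm_mem pu) mem_iota.
  have inj : injective (fun i : 'I_n => Ordinal (ltu i)).
    move=> i j /(congr1 val)/eqP; rewrite /= nth_uniq ?su // => /eqP ij.
    exact: val_inj.
  exists (perm inj); first by rewrite mem_enum.
  apply: (@eq_from_nth _ 0) => [|i]; rewrite su ?size_oneline // => hi.
  by rewrite (nth_oneline _ (Ordinal hi)) permE.
apply: uniq_perm; rewrite ?iota_uniq //.
  by rewrite map_inj_uniq ?enum_uniq // => i j /val_inj/perm_inj.
move=> x; rewrite mem_iota /= add0n; apply/mapP/idP => [[i _ ->]|xn]; first exact: ltn_ord.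
by exists ((s^-1)%g (Ordinal xn)); rewrite ?mem_enum // permKV.
Qed.

Lemma descents_pexact s cs : all (fun c => 0 < c) cs -> sumn cs < n ->
  same_set (descents s) (psums cs) = pexact cs (oneline s).
Proof.
move=> pos sn; have sn' : sumn cs < size (oneline s) by rewrite size_oneline.
have desE i : i \in descents s =
    (0 < i < n) && (nth 0 (oneline s) i < nth 0 (oneline s) i.-1).
  by rewrite mem_filter mem_iota andbC; congr andb; lia.
apply/andP/pexactP => //; rewrite size_oneline.
  case=> /allP h1 /allP h2 i hi; apply/idP/idP => [d|/h2 /=].
    by apply: h1; rewrite desE hi.
  by rewrite desE hi.
move=> h; split; apply/allP => i.
  by rewrite desE => /andP[hi]; rewrite h.
move=> ic; have hb := mem_psums_bounds pos ic.
have hi : 0 < i < n by lia.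
by rewrite /= desE hi h.
Qed.

Lemma beta_pexact cs m : all (fun c => 0 < c) cs -> sumn cs + m = n ->
  beta n cs m = \sum_(s : {perm 'I_n}) pexact cs (oneline s).
Proof.
move=> pos sn; rewrite /beta; case: posnP => [m0|m0].
  (* With pointed entry 0, an empty [cs] forces [n = 0] and a single permutation; otherwise the cuts
     exhaust the word. *)
  case: cs pos sn => [|x cs] pos sn.
    have n0 : n = 0 by rewrite -sn m0.
    rewrite (eq_bigr (fun=> 1)); last first.
      by move=> s _ /=; rewrite (size0nil (etrans (size_oneline s) n0)).
    by rewrite sum1_card card_Sn n0.
  by rewrite big1 // => s _; rewrite pexact_full // size_oneline; lia.
rewrite -sum1_card [LHS]big_mkcond; apply: eq_bigr => s _; rewrite inE.
have lt : sumn cs < n by lia.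
by rewrite descents_pexact //; case: pexact.
Qed.

End Permutations.

(** * Matching the enumeration of V, and the final computation *)

Lemma mem_seqs_len l b s :
  (s \in seqs_len l b) = (size s == l) && all (fun c => 0 < c <= b) s.
Proof.
elim: l s => [|l IH] s /=; first by case: s.
apply/allpairsP/idP => [[[x t] [/= xb tl ->]]|].
  by rewrite IH in tl; move: xb tl; rewrite mem_iota add1n ltnS /= eqSS => -> /andP[-> ->].
case: s => // x s /=; rewrite eqSS => /and3P[sl xb sb].
by exists (x, s); rewrite IH mem_iota add1n ltnS sl.
Qed.

Lemma mem_all_seqs b s : (s \in all_seqs b) = (size s <= b) && all (fun c => 0 < c <= b) s.
Proof.
rewrite mem_undup; apply/flatten_mapP/andP => [[l]|[sb sa]].
  by rewrite mem_iota mem_seqs_len add0n ltnS => lb /andP[/eqP -> ->].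
by exists (size s); rewrite ?mem_iota ?mem_seqs_len ?eqxx.
Qed.

Lemma perm_in_V n lam m :
  perm_eq [seq cs <- all_seqs n | in_V n lam m cs] [seq cs <- comps n | in_V n lam m cs].
Proof.
apply: uniq_perm; rewrite ?filter_uniq ?undup_uniq ?comps_uniq // => cs.
rewrite !mem_filter; apply: andb_id2l => /andP[/andP[/andP[pos /eqP sn] _] _].
have sm : small n cs by rewrite /small pos; lia.
rewrite mem_comps mem_all_seqs pos; have -> : sumn cs <= n by lia.
apply/andP; split; last by apply/allP => x; apply: small_mem.
by apply: leq_trans (size_le_sumn pos) _; rewrite -sn leq_addr.
Qed.

(** [dec] is positive exactly when the parts of [lam] can be grouped into [cs], and for a knapsack
    partition it is at most 1, so it is the indicator of the filter. *)
Lemma in_filter_dec n lam m cs : is_pip n (lam, m) -> knapsack lam ->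
  all (fun c => 0 < c) cs -> sumn cs <= n ->
  dec (mset_of n lam) cs = `[< in_filter (lam, m) (cs, n - sumn cs) >] :> nat.
Proof.
move=> /andP[/= pos /eqP sn] kn posc sc.
have sm : small n lam by rewrite /small pos; lia.
have le1 := dec_le1 cs (@knapsack_inj _ _ sm kn) (mle_refl (mset_of n lam)).
have [d0 d1] := dec_gt0 cs sm.
case: asboolP => [/pip_le_splits[ls [r [/= p e er]]]|nf] /=.
  by have : 0 < dec (mset_of n lam) cs; [apply: d1; exists ls, r|lia].
case: (posnP (dec (mset_of n lam) cs)) => // /d0[ls [r [p e]]]; case: nf; apply: (@splits_pip_le (lam, m) (cs, n - sumn cs)) => //.
exists ls, r; split => //=; have := perm_sumn p.
by rewrite sumn_cat sumn_flatten e; lia.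
Qed.

Theorem theorem4p5 (n : nat) (lam : seq nat) (m : nat) :
  is_pip n (lam, m) -> knapsack lam ->
  mu_PiF n (lam, m) = ((-1) ^+ (size lam).+1 * sum_beta_V n lam m)%R.
Proof.
move=> hp kn; have /andP[/= pos /eqP sn] := hp.
have sm : small n lam by rewrite /small pos; lia.
set L := mset_of n lam.
rewrite (@mu_PiF_ops n) // big_mkcond /=.
(* The summand depends only on the block sizes, the form that [sum_ops_words] requires. *)
pose Phi (cs : seq nat) : int :=
  if `[< in_filter (lam, m) (cs, n - sumn cs) >] then ((-1) ^+ size cs)%R else 0%R.
rewrite (eq_bigr (fun l : seq {set 'I_n} => Phi [seq #|B| | B : {set 'I_n} <- l])); last first.
  by move=> l _; rewrite /Phi size_map.
rewrite sum_ops_words (perm_big _ (perm_onelines n)) big_image /=.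
(* The exponent [(size lam).+1] has the parity of p - 1; its extra factor -1 is the sign coming from
   duality. *)
rewrite exprS -mulrA mulN1r; congr (- _)%R.
rewrite (eq_bigr (fun s : {perm 'I_n} => \sum_(cs <- comps n | in_V n lam m cs)
   (-1) ^+ size lam * (pexact cs (oneline s))%:R)%R); last first.
  (* For a fixed permutation, pass from refinements weighted by [dec] to exact run decompositions
     weighted by [vdec]; the latter weight is the sign of [lam] on V and 0 elsewhere. *)
  move=> s _; transitivity (refine_sum L (oneline s)).
    rewrite cardsT card_ord /refine_sum size_oneline; apply: eq_big_seq => cs.
    rewrite mem_comps => /andP[posc sc]; rewrite (in_filter_dec hp) // /Phi.
    by case: asbool; rewrite ?mulr1 ?mulr0.
  rewrite (@refine_sum_run_sum _ m) ?size_oneline ?msum_mset_of //.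
  rewrite /run_sum size_oneline big_mkcond [RHS]big_mkcond; apply: eq_big_seq => cs.
  rewrite mem_comps => /andP[posc sc]; rewrite /in_V posc /=; case: eqP => //= e.
  rewrite (@vdecE _ L (distinct_summands lam)) ?mle_refl //; last 2 first.
  - by move=> M X XM ML; apply: distinct_summandsE.
  - by rewrite msum_mset_of //; lia.
  rewrite (in_filter_dec hp) // msize_mset_of //; have -> : n - sumn cs = m by lia.
  by case: asbool; case: (all _ cs); rewrite ?mulr1 ?mulr0 ?mul0r.
rewrite exchange_big /= /sum_beta_V -[in RHS]big_filter (perm_big _ (perm_in_V n lam m)) /=.
rewrite big_filter mulr_sumr; apply: eq_bigr => cs /andP[/andP[/andP[posc /eqP e] _] _].
rewrite -mulr_sumr beta_pexact //; congr (_ * _)%R.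
by rewrite -natz natr_sum.
Qed.
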